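(* Let $K$ be a Stonean space. Then $K$ is hyper-Stonean if and only if there exists a collection $\mathcal{U}$ of clopen subsets of $K$ such that $\bigcup\mathcal{U}$ is dense in $K$ and every $U\in\mathcal{U}$ (with the subspace topology) satisfies property ( *** ).
   Context: A Stonean space is a compact Hausdorff space in which the closure of every open set is open. $\mathrm{C}(K)$ is the Banach lattice of continuous real-valued functions on $K$. A normal measure on $K$ is a regular, $\sigma$-additive, real-valued signed Borel measure $\mu$ on $K$ whose associated functional $f\mapsto\int_K f\,d\mu$ on $\mathrm{C}(K)$ is order continuous, i.e. $\inf\{|\int_K f\,d\mu|:f\in D\}=0$ for every downward directed set $D\subseteq\mathrm{C}(K)$ with infimum $0$ in $\mathrm{C}(K)$. A Stonean space $K$ is hyper-Stonean if the union of the supports of the normal measures on $K$ is dense in $K$. Kelley intersection number: for a nonempty set $X$ and a collection $\mathcal{F}$ of nonempty subsets of $X$, for $n\in\mathbb{N}$ and $\bar F=\langle F_1,\dots,F_n\rangle\in\mathcal{F}^n$ let $i(\bar F)=\max\{|J|:J\subseteq\{1,\dots,n\},\ \bigcap_{j\in J}F_j\neq\emptyset\}$, and let $k(\mathcal{F})=\inf\{i(\bar F)/n:n\in\mathbb{N},\ \bar F\in\mathcal{F}^n\}$. Property ( *** ): for a compact Hausdorff space $L$ let $\mathcal{T}$ be the collection of nonempty open subsets of $L$. $L$ satisfies property ( *** ) if there is a partition $\{\mathcal{T}_n:n\in\mathbb{N}\}$ of $\mathcal{T}$ such that for every $n\in\mathbb{N}$: (a) $k(\mathcal{T}_n)>0$;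 (b) if $(U_m)$ is an increasing sequence of open sets with $\bigcup_{m}U_m\in\mathcal{T}_n$, then there is $m_0\in\mathbb{N}$ with $U_{m_0}\in\mathcal{T}_n$; (c) if $U\in\mathcal{T}_n$ and $V$ is an open set such that $U\Delta V$ is meagre, then $V\in\mathcal{T}_n$. *)

(* Defs.v *)
From HB Require Import structures.
From mathcomp Require Import all_boot all_order all_algebra.
From mathcomp Require Import all_classical all_reals all_analysis.

Set Implicit Arguments.
Unset Strict Implicit.
Unset Printing Implicit Defensive.

Import Order.TTheory GRing.Theory Num.Theory.
Import numFieldNormedType.Exports.

Local Open Scope classical_set_scope.
Local Open Scope ring_scope.

Definition stonean (K : topologicalType) :=
  [/\ compact [set: K], hausdorff_space K &
      forall U : set K, open U -> open (closure U)].

(* The types carrying a sigma-algebra are pointed, whereas K may be empty: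
   the base point x0 is an explicit parameter, with no mathematical content. *)
Definition pointed_at (K : topologicalType) (x0 : K) : Type := K.
HB.instance Definition _ (K : topologicalType) (x0 : K) :=
  Topological.on (pointed_at x0).
HB.instance Definition _ (K : topologicalType) (x0 : K) :=
  isPointed.Build (pointed_at x0) x0.

Notation borel x0 := (g_sigma_algebraType (@open (pointed_at x0))).

Section signed_measures.
Context d (T : measurableType d) (R : realType).
Variable mu : {charge set T -> \bar R}.

Lemma hahn_exists : exists PN, hahn_decomposition mu PN.1 PN.2.
Proof. by have [P [N PN]] := Hahn_decomposition mu; exists (P, N). Qed.

(* The Jordan parts do not depend on the choice of the Hahn decomposition. *)
Definition charge_pos_part : {finite_measure set T -> \bar R} :=
  jordan_pos (projT2 (cid hahn_exists)).
Definition charge_neg_part : {finite_measure set T -> \bar R} :=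
  jordan_neg (projT2 (cid hahn_exists)).
Definition charge_total_variation : {measure set T -> \bar R} :=
  charge_variation (projT2 (cid hahn_exists)).

Definition charge_integral (f : T -> R) : R :=
  Rintegral charge_pos_part [set: T] f - Rintegral charge_neg_part [set: T] f.

End signed_measures.

Section normal_measures.
Context (R : realType) (K : topologicalType).

Local Notation C := (continuousType K R).

Definition downward_directed (D : set C) :=
  D !=set0 /\
  forall f g : C, D f -> D g ->
    exists2 h : C, D h & forall x, h x <= f x /\ h x <= g x.

Definition has_inf0 (D : set C) :=
  (forall f : C, D f -> forall x, 0 <= f x) /\
  forall g : C, (forall f : C, D f -> forall x, g x <= f x) ->
    forall x, g x <= 0.

Definition order_continuous (phi : C -> R) :=
  forall D : set C, downward_directed D -> has_inf0 D ->
    inf [set `|phi f| | f in D] = 0.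

Variable x0 : K.
Variable mu : {charge set (borel x0) -> \bar R}.

Definition regular_charge :=
  forall (A : set (borel x0)) (e : R), measurable A -> 0 < e ->
    exists F U : set K,
      [/\ compact F, open U, F `<=` A, A `<=` U &
          (charge_total_variation mu (U `\` F) < e%:E)%E].

Definition normal_measure :=
  regular_charge /\ order_continuous (fun f : C => charge_integral mu f).

Definition charge_support : set K :=
  [set x | forall U : set K, open_nbhs x U -> (0 < charge_total_variation mu U)%E].

End normal_measures.

Definition hyper_stonean (R : realType) (K : topologicalType) :=
  stonean K /\
  dense [set x : K | exists (x0 : K) (mu : {charge set (borel x0) -> \bar R}),
                       normal_measure mu /\ charge_support mu x].

Definition kelley_i (X : Type) (n : nat) (F : 'I_n -> set X) : nat :=
  \max_(J : {set 'I_n} | `[< \bigcap_(j in [set` J]) F j !=set0 >]) #|J|.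

(* As an extended real infimum, this is +oo for the empty collection. *)
Definition kelley_k (R : realType) (X : Type) (FF : set (set X)) : \bar R :=
  ereal_inf [set r | exists (n : nat) (F : 'I_n -> set X),
    [/\ (0 < n)%N, forall j, FF (F j) &
        r = ((kelley_i F)%:R / n%:R : R)%:E]].

Definition nowhere_dense (L : topologicalType) (A : set L) :=
  (closure A)° = set0.

Definition meagre (L : topologicalType) (A : set L) :=
  exists2 F : (set L)^nat, forall n, nowhere_dense (F n) & A = \bigcup_n F n.

(* Property "three stars". The classes TT n may be empty. *)
Definition property_star3 (R : realType) (L : topologicalType) :=
  exists TT : nat -> set (set L),
    [/\ trivIset [set: nat] TT,
        \bigcup_n TT n = [set U | open U /\ U !=set0] &
        forall n : nat,
          [/\ (0 < kelley_k R (TT n))%E,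
              forall U : (set L)^nat, (forall m, open (U m)) ->
                nondecreasing_seq U -> TT n (\bigcup_m U m) ->
                exists m0, TT n (U m0) &
              forall U V : set L, TT n U -> open V ->
                meagre (U `+` V) -> TT n V]].

(* Main.v *)
(* If [mu] is normal, [|mu|] vanishes on meagre sets and is strictly positive on
   its support [S], which is clopen; the open [V <= S] with [|mu| V] in the
   interval (1/(n+1), 1/n] form the n-th class of the three-star property.

   Conversely let [U] have the three-star property.  By Kelley's theorem, here
   a Hahn-Banach argument, a class with positive intersection number carries a
   finitely additive [m], defined on all subsets, that is bounded below on the
   class by a positive constant; a weighted sum handles all classes at once.
   Put [nu A = inf (sum_k m (C_k))] over the sequences of clopen sets [C_k] that
   cover [A] up to a meagre set.  This outer measure makes all Borel sets
   measurable and meagre sets null.  If [V] lies in the n-th class and the [C_k]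
   cover [V] up to a meagre set, then (b) and (c) put some
   [V /\ (C_0 \/ ... \/ C_k)] in the same class, so the lower bound of [m] on
   the class bounds [nu V] as well.  Hence [nu] is strictly positive on [U], and
   an exhaustion argument gives regularity and order continuity. *)
Require Import Defs.
From HB Require Import structures.
From mathcomp Require Import all_boot all_order all_algebra.
From mathcomp Require Import all_classical all_reals all_analysis.
From mathcomp Require Import finmap measurable_realfun lra.

Set Implicit Arguments.
Unset Strict Implicit.
Unset Printing Implicit Defensive.

Import Order.TTheory GRing.Theory Num.Theory.
Import numFieldNormedType.Exports.

Local Open Scope classical_set_scope.
Local Open Scope ring_scope.

(** * Sublinear functionals on abelian groups *)

Section hahn_banach.
Context (R : realType) (G : zmodType).
Implicit Types (p q : G -> R) (x y : G).

(** Natural multiples are the only nonnegative scalars at hand in an abelian group; an additive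
    minorant asks for no others. *)
Definition nat_sublinear q :=
  (forall x y, q (x + y) <= q x + q y) /\ (forall x n, q (x *+ n) = q x *+ n).

Lemma nat_sublinear0 q : nat_sublinear q -> q 0 = 0.
Proof. by case=> _ qM; rewrite -(mulr0n 0) qM mulr0n. Qed.

Lemma nat_sublinearN q x : nat_sublinear q -> - q (- x) <= q x.
Proof.
move=> qs; rewrite -subr_ge0 opprK -(nat_sublinear0 qs) -(subrr x).
exact: qs.1.
Qed.

(** Each closure condition on [S] passes to infima: the last one, a division by [n], gives
    [inf (S x) *+ n <= inf (S (x *+ n))], the one before it the converse. The chains in Zorn's
    lemma, the minimality argument and Kelley's theorem all obtain their functionals this way. *)
Lemma inf_nat_sublinear (S : G -> set R) :
  (forall x, S x !=set0) -> (forall x, has_lbound (S x)) ->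
  (forall x y a b, S x a -> S y b -> exists2 c, S (x + y) c & c <= a + b) ->
  (forall x n a, S x a -> exists2 c, S (x *+ n) c & c <= a *+ n) ->
  (forall x n a, S (x *+ n) a -> exists2 c, S x c & c *+ n <= a) ->
  nat_sublinear (fun x => inf (S x)).
Proof.
move=> S0 Slb SD SM SMV.
have infle x a : S x a -> inf (S x) <= a by move=> Sa; exact: ge_inf.
have leinf x b : (forall a, S x a -> b <= a) -> b <= inf (S x).
  by move=> h; apply: lb_le_inf => // a; exact: h.
split=> [x y|x n].
  rewrite -lerBlDr; apply: (leinf _ _) => a Sa; rewrite lerBlDr -lerBlDl.
  apply: (leinf _ _) => b Sb; rewrite lerBlDl.
  by have [c Sc cab] := SD _ _ _ _ Sa Sb; exact: le_trans (infle _ _ Sc) cab.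
apply/eqP; rewrite eq_le; apply/andP; split; last first.
  apply: (leinf _ _) => a /SMV[c Sc]; apply: le_trans.
  by rewrite lerMn2r infle ?orbT.
(* No division is possible for [n = 0], but there any element of [S x] already yields some [c <= 0]
   in [S (x *+ 0)]. *)
case: n => [|n].
  have [a Sa] := S0 x; have [c Sc] := SM _ 0%N _ Sa.
  by rewrite !mulr0n in Sc *; exact: le_trans (infle _ _ Sc).
rewrite -mulr_natr -ler_pdivrMr ?ltr0n//; apply: (leinf _ _) => a Sa.
rewrite ler_pdivrMr ?ltr0n// mulr_natr.
by have [c Sc] := SM _ n.+1 _ Sa; exact: le_trans (infle _ _ Sc).
Qed.

(** Zorn's lemma for the reversed pointwise order on the sublinear minorants of [p]. A nonempty
    chain is bounded by its pointwise infimum, which is finite because every minorant [s] satisfies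
    [- p (- x) <= - s (- x) <= s x]. *)
Lemma nat_sublinear_minimal p : nat_sublinear p ->
  exists q, [/\ nat_sublinear q, forall x, q x <= p x &
    forall r, nat_sublinear r -> (forall x, r x <= q x) -> r = q].
Proof.
move=> ps; pose P q := nat_sublinear q /\ forall x, q x <= p x.
pose T := {q | P q}.
pose Rel (s t : T) := `[< forall x, sval t x <= sval s x >].
have [|||F Ftot|[q [qs qp]] qmin] := @Zorn T Rel.
- by move=> t; apply/asboolP.
- move=> r s t /asboolP rs /asboolP st; apply/asboolP => x.
  exact: le_trans (st x) (rs x).
- move=> [s s'] [t t'] /asboolP/= st /asboolP/= ts; apply: eq_exist.
  by apply/funext => x; apply: le_anti; rewrite st ts.
- have [[s0 Fs0]|F0] := pselect (F !=set0); last first.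
    exists (exist P p (conj ps (fun x => lexx (p x)))) => s Fs.
    by exfalso; apply: F0; exists s.
  pose S x := [set sval s x | s in F].
  have Slb x : has_lbound (S x).
    exists (- p (- x)) => _ [[s [ss sp]] _ <-] /=.
    by apply: le_trans (nat_sublinearN x ss); rewrite lerN2.
  have rs : nat_sublinear (fun x => inf (S x)).
    apply: inf_nat_sublinear => //.
    + by move=> x; exists (sval s0 x); exists s0.
    + move=> x y _ _ [s Fs <-] [t Ft <-].
      have [/asboolP st|/asboolP ts] := Ftot s t Fs Ft.
        exists (sval t (x + y)); first by exists t.
        by apply: le_trans ((svalP t).1.1 x y) _; rewrite lerD2r.
      exists (sval s (x + y)); first by exists s.
      by apply: le_trans ((svalP s).1.1 x y) _; rewrite lerD2l.
    + move=> x n _ [s Fs <-]; exists (sval s (x *+ n)); first by exists s.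
      by rewrite (svalP s).1.2.
    + move=> x n _ [s Fs <-]; exists (sval s x); first by exists s.
      by rewrite (svalP s).1.2.
  have rle x s : F s -> inf (S x) <= sval s x.
    by move=> Fs; apply: ge_inf => //; exists s.
  have rp x : inf (S x) <= p x.
    by apply: le_trans (rle x _ Fs0) _; exact: (svalP s0).2.
  by exists (exist P _ (conj rs rp)) => s Fs; apply/asboolP => x /=; exact: rle.
- exists q; split=> // r rs rq.
  have rp x : r x <= p x by exact: le_trans (rq x) (qp x).
  by have /(congr1 sval) := qmin (exist P r (conj rs rp)) (asboolT rq).
Qed.

(* A minimal sublinear functional is additive, since it equals each of its
   own minorants [x |-> inf_n (q (x + n y) - n q y)]. *)
Lemma additive_minorant p : nat_sublinear p ->
  exists phi : G -> R, (forall x y, phi (x + y) = phi x + phi y) /\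
                       forall x, phi x <= p x.
Proof.
move=> /nat_sublinear_minimal[q [qs qp qmin]]; exists q; split=> // x y.
apply/eqP; rewrite eq_le qs.1/= -lerBrDr.
pose S z := range (fun n : nat => q (z + y *+ n) - q y *+ n).
have Slb z : has_lbound (S z).
  exists (- q (- z)) => _ [n _ <-].
  rewrite lerBrDr -qs.2 addrC lerBlDr [leRHS]addrC.
  by rewrite -{1}[y *+ n](addKr z) qs.1.
have rs : nat_sublinear (fun z => inf (S z)).
  apply: inf_nat_sublinear => //.
  - by move=> z; exists (q (z + y *+ 0) - q y *+ 0); exists 0%N.
  - move=> z t _ _ [n _ <-] [m _ <-].
    exists (q (z + t + y *+ (n + m)) - q y *+ (n + m)).
      by exists (n + m)%N.
    rewrite !mulrnDr addrACA [leRHS]addrACA -opprD lerD2r; exact: qs.1.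
  - move=> z n _ [m _ <-].
    exists (q (z *+ n + y *+ (m * n)) - q y *+ (m * n)).
      by exists (m * n)%N.
    by rewrite mulrnBl -(qs.2 (z + _)) mulrnDl -!mulrnA.
  - move=> z n _ [m _ <-].
    exists (q (z + y *+ m) - q y *+ m); first by exists m.
    case: n => [|n].
      by rewrite !mulr0n add0r qs.2 subrr.
    have e : (z + y *+ m) *+ n.+1 = z *+ n.+1 + y *+ m + y *+ (m * n).
      by rewrite mulrnDl -mulrnA mulnS mulrnDr addrA.
    rewrite mulrnBl -(qs.2 (z + _)) e.
    apply: le_trans (lerB (qs.1 _ _) (lexx _)) _.
    by rewrite qs.2 -mulrnA mulnS mulrnDr opprD addrACA subrr addr0.
have rq z : inf (S z) <= q z.
  by apply: ge_inf => //; exists 0%N => //; rewrite !mulr0n addr0 subr0.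
(* Minimality identifies [inf (S x)] with [q x]; its term for [n = 1] gives
   [q x <= q (x + y) - q y], the missing half of additivity. *)
have <- : inf (S x) = q x by rewrite -[RHS](congr1 (@^~ x) (qmin _ rs rq)).
by apply: ge_inf => //; exists 1%N => //; rewrite !mulr1n.
Qed.

End hahn_banach.

(** * Kelley's theorem on intersection numbers *)

Section kelley.
Context (R : realType).

(** A finite family with repetitions, as in the definition of the intersection number, is retained
    only through its length [N] and its multiplicity function [g]. *)
Definition indicator_sum (X : Type) (FF : set (set X)) (N : nat) (g : X -> R) :=
  exists2 F : 'I_N -> set X, (forall i, FF (F i)) &
    g = fun x => \sum_(i < N) \1_(F i) x.

Lemma indicator_sum0 (X : Type) (FF : set (set X)) :
  indicator_sum FF 0 (cst 0).
Proof.
exists (fun=> set0); first by case.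
by apply/funext => x; rewrite big_ord0.
Qed.

Lemma indicator_sum1 (X : Type) (FF : set (set X)) A :
  FF A -> indicator_sum FF 1 \1_A.
Proof.
by move=> FA; exists (fun=> A) => //; apply/funext => x; rewrite big_ord1.
Qed.

Lemma indicator_sumD (X : Type) (FF : set (set X)) N M g h :
  indicator_sum FF N g -> indicator_sum FF M h ->
  indicator_sum FF (N + M) (g \+ h).
Proof.
move=> [F FFF ->] [H FFH ->].
exists (fun i : 'I_(N + M) =>
  match fintype.split i with inl j => F j | inr j => H j end).
  by move=> i; case: fintype.split.
apply/funext => x /=; rewrite big_split_ord /=; congr (_ + _).
  by apply: eq_bigr => i _; rewrite -[lshift _ _]/(unsplit (inl i)) unsplitK.
by apply: eq_bigr => i _; rewrite -[rshift _ _]/(unsplit (inr i)) unsplitK.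
Qed.

Lemma indicator_sumMn (X : Type) (FF : set (set X)) N g n :
  indicator_sum FF N g -> indicator_sum FF (N * n) (fun x => g x *+ n).
Proof.
move=> FFg; elim: n => [|n IHn].
  by rewrite muln0; exact: indicator_sum0.
rewrite mulnS; have := indicator_sumD FFg IHn; congr (indicator_sum _ _).
by apply/funext => x /=; rewrite mulrS.
Qed.

(** A largest subfamily with a common point has at least [c *+ N] members, and at that point [g]
    counts them all. *)
Lemma kelley_k_point (X : Type) (FF : set (set X)) (c : R) (x0 : X) N g :
  (c%:E <= kelley_k R FF)%E -> indicator_sum FF N g ->
  exists x, c *+ N <= g x.
Proof.
move=> ck [F FFF ->]; case: N F FFF => [|N] F FFF.
  by exists x0; rewrite big_ord0 mulr0n.
have ci : c *+ N.+1 <= (kelley_i F)%:R.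
  rewrite -(mulr_natr c) -ler_pdivlMr ?ltr0n// -lee_fin; apply: le_trans ck _.
  by apply: ereal_inf_lbound; exists N.+1, F.
have [|J /asboolP[x Jx] iJ] := eq_bigmax_cond (fun J : {set 'I_N.+1} => #|J|)
  (A := fun J : {set 'I_N.+1} => `[< \bigcap_(j in [set` J]) F j !=set0 >]).
  apply/card_gt0P; exists (finset.set0); apply/asboolP; exists x0 => j /=.
  by rewrite finset.in_set0.
exists x; apply: (le_trans ci).
rewrite (iJ : kelley_i F = _) -sum1_card natr_sum big_mkcond /=.
apply: ler_sum => i _; rewrite indicE; case: ifPn => // iJx.
by rewrite (_ : x \in F i = true) //; apply/mem_set/Jx.
Qed.

Let avgD (u v g h a b c : R) n m N M :
  (u *+ n + g) *+ m <= (a *+ n + c *+ N) *+ m ->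
  (v *+ m + h) *+ n <= (b *+ m + c *+ M) *+ n ->
  (u + v) *+ (n * m) + (g *+ m + h *+ n) <=
  (a + b) *+ (n * m) + c *+ (N * m + M * n).
Proof.
rewrite !mulrnDl mulrnDr -!mulrnA ![(m * n)%N]mulnC => h1 h2.
have := lerD h1 h2.
rewrite addrACA [(a *+ _ + _) + _]addrACA.
by [].
Qed.

Let avgM (u g a c : R) n k N :
  (u *+ k + g) *+ n <= (a *+ k + c *+ N) *+ n ->
  u *+ n *+ k + g *+ n <= a *+ n *+ k + c *+ (N * n).
Proof. by rewrite !mulrnDl -!mulrnA !(mulnC n k). Qed.

Let fimfunMn (X : Type) (f : {fimfun X >-> R}) n x : (f *+ n) x = f x *+ n.
Proof. by elim: n => // n IHn; rewrite !mulrS fimfunD /= IHn. Qed.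

Lemma kelley (X : pointedType) (FF : set (set X)) (c : R) :
  (c%:E <= kelley_k R FF)%E ->
  exists m : set X -> R,
    [/\ forall A, 0 <= m A,
        forall A B, A `&` B = set0 -> m (A `|` B) = m A + m B,
        m setT <= 1 & forall A, FF A -> c <= m A].
Proof.
(* Functions of finite range are bounded and include the indicators of all subsets. *)
move=> ck; pose G : zmodType := {fimfun X >-> R}.
(* [inf (S f)] is at most [sup f], and at most [- c] at [- \1_A] when [FF A]:
   an additive functional below it is positive, of norm at most 1, and at least
   [c] on [FF].  The hypothesis on [FF] says that [inf (S 0) >= 0]. *)
pose S (f : G) := [set a : R | exists n N g,
  [/\ (0 < n)%N, indicator_sum FF N g &
      forall x, f x *+ n + g x <= a *+ n + c *+ N]].
(* At a point with [c *+ N <= g x] the defining inequality leaves [f x <= a]; this bounds [S f] from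
   below. *)
have S_ge (f : G) a : S f a -> exists x, f x <= a.
  move=> [n [N [g [n0 FFg fa]]]]; have [x cg] := kelley_k_point point ck FFg.
  exists x; have := lerMn2r n (f x) a; rewrite gtn_eqF//= => <-;
  rewrite -(lerD2r (c *+ N)).
  by apply: le_trans (fa x); rewrite lerD2l.
have fin_bound (f : G) : exists M, forall x, `|f x| <= M.
  have /finite_seqP[r fr] := fimfunP f.
  exists (\sum_(y <- r) `|y|) => x.
  have : f x \in r by move: fr => /seteqP[/(_ (f x)) + _]; apply; exists x.
  by move=> fxr; rewrite (big_rem _ fxr)/= lerDl sumr_ge0.
have Ssub (f : G) a : (forall x, f x <= a) -> S f a.
  move=> fa; exists 1%N, 0%N, (cst 0); split=> //.
    exact: indicator_sum0.
  by move=> x; rewrite !mulr1n mulr0n !addr0.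
have : nat_sublinear (fun f : G => inf (S f)).
  apply: inf_nat_sublinear.
  - move=> f; have [M fM] := fin_bound f; exists M; apply: Ssub => x.
    exact: le_trans (ler_norm _) (fM x).
  - move=> f; have [M fM] := fin_bound f; exists (- M) => a /S_ge[x fxa].
    by apply: le_trans fxa; have := fM x; rewrite ler_norml => /andP[].
  - move=> f g a b [n [N [h [n0 hN fh]]]] [n' [N' [h' [n'0 hN' gh]]]].
    exists (a + b) => //; exists (n * n')%N, (N * n' + N' * n)%N.
    exists (fun x => h x *+ n' + h' x *+ n); split.
    + by rewrite muln_gt0 n0.
    + by apply: indicator_sumD; exact: indicator_sumMn.
    + move=> x; have fhx : (f x *+ n + h x) *+ n' <= (a *+ n + c *+ N) *+ n'.
        by rewrite lerMn2r fh orbT.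
      have ghx : (g x *+ n' + h' x) *+ n <= (b *+ n' + c *+ N') *+ n.
        by rewrite lerMn2r gh orbT.
      have -> : (f + g) x = f x + g x by [].
      exact: avgD fhx ghx.
  - move=> f n a [k [N [h [k0 hN fh]]]]; exists (a *+ n) => //.
    exists k, (N * n)%N, (fun x => h x *+ n); split=> //.
      exact: indicator_sumMn.
    move=> x; have : (f x *+ k + h x) *+ n <= (a *+ k + c *+ N) *+ n.
      by rewrite lerMn2r fh orbT.
    have -> : (f *+ n) x = f x *+ n by rewrite fimfunMn.
    exact: avgM.
  - move=> f [|n] a.
      move=> /S_ge[x]; rewrite mulr0n => a0.
      have [M fM] := fin_bound f; exists M; last by rewrite mulr0n.
      by apply: Ssub => y; exact: le_trans (ler_norm _) (fM y).
    move=> [k [N [h [k0 hN fh]]]].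
    have an : (a / n.+1%:R) *+ n.+1 = a by rewrite -mulr_natr divfK ?pnatr_eq0.
    exists (a / n.+1%:R); last by rewrite an.
    exists (n.+1 * k)%N, N, h; split=> //; first by rewrite muln_gt0.
    by move=> x; have := fh x; rewrite fimfunMn !mulrnA an.
move=> /additive_minorant[phi [phiD phile]].
have phi_le f a : S f a -> phi f <= a.
  move=> Sfa; apply: le_trans (phile f) _; apply: ge_inf => //.
  have [M fM] := fin_bound f; exists (- M) => b /S_ge[x fxb].
  by apply: le_trans fxb; have := fM x; rewrite ler_norml => /andP[].
have phi0 : phi 0 = 0.
  by have := phiD 0 0; rewrite addr0; lra.
have phiN f : phi (- f) = - phi f.
  by have := phiD f (- f); rewrite subrr phi0; lra.
exists (fun A => phi (indic_fimfun A)); split.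
- move=> A; rewrite -oppr_le0 -phiN; apply: phi_le; apply: Ssub => x /=.
  by rewrite oppr_le0 indicE.
- move=> A B AB; rewrite -phiD; congr phi; apply/fimfuneqP => x /=.
  rewrite -[RHS]/(\1_A x + \1_B x) !indicE in_setU.
  case: (boolP (x \in A)); case: (boolP (x \in B)); rewrite ?addr0 ?add0r //.
  by move=> /set_mem xB /set_mem xA; have : (A `&` B) x by []; rewrite AB.
- by apply: (phi_le (indic_fimfun setT)); apply: Ssub => x /=; rewrite indicT.
- move=> A FA; rewrite -lerN2 -phiN; apply: phi_le.
  exists 1%N, 1%N, \1_A; split=> //; first exact: indicator_sum1.
  by move=> x /=; rewrite !mulr1n !addNr.
Qed.

End kelley.

(** * Meagre sets and Stonean spaces *)

Section nowhere_dense_sets.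
Context (K : topologicalType).
Implicit Types A B U W : set K.

Lemma nowhere_denseP A : nowhere_dense A <->
  forall W, open W -> W !=set0 ->
    exists W', [/\ open W', W' !=set0, W' `<=` W & W' `&` A = set0].
Proof.
split=> [ndA W oW W0|h].
  exists (W `\` closure A); split.
  - by apply: openI => //; apply: closed_openC; exact: closed_closure.
  - apply/set0P/eqP; rewrite setD_eq0 => WA.
    move: W0 => /set0P/eqP; apply; rewrite -subset0 -ndA.
    by rewrite -[W](interior_id W).1//; exact: interiorS.
  - exact: subDsetl.
  - by rewrite -subset0 => x [[_ nx] Ax]; apply: nx; exact: subset_closure.
apply: contrapT => /eqP/set0P cA0.
have [W' [oW' [x W'x] W'cA W'A]] := h _ (open_interior _) cA0.
have cAx : closure A x := interior_subset (W'cA _ W'x).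
have [y [Ay W'y]] := cAx _ (open_nbhs_nbhs (conj oW' W'x)).
by have : (W' `&` A) y by []; rewrite W'A.
Qed.

Lemma nowhere_denseS A B : A `<=` B -> nowhere_dense B -> nowhere_dense A.
Proof.
move=> AB ndB; rewrite /nowhere_dense -subset0 -ndB.
exact/interiorS/closureS.
Qed.

(** The boundary of [U]: an open set that meets [U] can be shrunk into [U], and one that does not
    meet [U] misses [closure U] as well. *)
Lemma nowhere_dense_closureD U : open U -> nowhere_dense (closure U `\` U).
Proof.
move=> oU; apply/nowhere_denseP => W oW W0.
have [WU|WU] := eqVneq (W `&` U) set0; last first.
  exists (W `&` U); split; [exact: openI|exact/set0P|by move=> x []|].
  by rewrite -subset0 => x [[_ ?] []].
exists W; split=> //; rewrite -subset0 => x [Wx [cUx _]].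
have [y [Uy Wy]] := cUx _ (open_nbhs_nbhs (conj oW Wx)).
by have : (W `&` U) y by []; rewrite WU.
Qed.

Lemma meagreS A B : A `<=` B -> meagre B -> meagre A.
Proof.
move=> AB [F ndF BF]; exists (fun n => A `&` F n).
  by move=> n; apply: nowhere_denseS (ndF n); exact: subIsetr.
by rewrite -setI_bigcupr -BF; apply/esym/setIidPl.
Qed.

Lemma nowhere_dense_meagre A : nowhere_dense A -> meagre A.
Proof. by move=> ndA; exists (fun=> A) => //; rewrite bigcup_const. Qed.

Lemma meagre_bigcup (A : (set K)^nat) :
  (forall n, meagre (A n)) -> meagre (\bigcup_n A n).
Proof.
move=> mA; have /choice[F hF] n : exists F : (set K)^nat,
    (forall m, nowhere_dense (F m)) /\ A n = \bigcup_m F m.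
  by have [F] := mA n; exists F.
(* The double sequence is enumerated through codes of pairs; numbers that code no pair contribute
   the empty set. *)
exists (fun k => if choice.unpickle k is Some p then F p.1 p.2 else set0)
  => [k|].
  case: choice.unpickle => [p|]; first exact: (hF _).1.
  by rewrite /nowhere_dense closure0 interior0.
apply/seteqP; split=> [x [n _]|x [k _]].
  rewrite (hF n).2 => -[m _ Fx]; exists (choice.pickle (n, m)) => //.
  by rewrite choice.pickleK.
case: choice.unpickle => [[n m]/= Fx|//]; exists n => //; rewrite (hF n).2.
by exists m.
Qed.

End nowhere_dense_sets.

(** * Meagre sets in an open subspace *)

Section open_subspace.
Context (K : topologicalType) (U : set K).
Hypothesis oU : open U.
Implicit Types A : set K.

Lemma nowhere_dense_preimage_val A :
  nowhere_dense A -> nowhere_dense (set_val @^-1` A : set (set_type U)).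
Proof.
move=> /nowhere_denseP ndA; apply/nowhere_denseP => _ [M oM <-] [x Mx].
have [||W' [oW' [y W'y] W'M W'A]] := ndA (M `&` U).
- exact: openI.
- by exists (set_val x); split => //; exact: set_valP.
- have [My Uy] := W'M _ W'y.
  exists (set_val @^-1` W'); split.
  + by exists W'.
  + by exists (exist _ y (mem_set Uy)).
  + by move=> z /= /W'M[].
  + by rewrite -preimage_setI W'A preimage_set0.
Qed.

(** An open set that misses [U] misses the image too; otherwise its trace is shrunk inside the
    subspace and, [U] being open, the result is open in [K]. *)
Lemma nowhere_dense_image_val (B : set (set_type U)) :
  nowhere_dense B -> nowhere_dense (set_val @` B).
Proof.
move=> /nowhere_denseP ndB; apply/nowhere_denseP => W oW W0.
have [WU|/set0P[x [Wx Ux]]] := eqVneq (W `&` U) set0.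
  exists W; split=> //; rewrite -subset0 => z [Wz [y _ yz]].
  by rewrite -WU; split=> //; rewrite -yz; exact: set_valP.
have [||V [[M oM <-] [y My] MW MB]] := ndB (set_val @^-1` W).
- by exists W.
- by exists (exist _ x (mem_set Ux)).
- exists (M `&` U); split.
  + exact: openI.
  + by exists (set_val y); split => //; exact: set_valP.
  + move=> z [Mz Uz]; exact: (MW (exist _ z (mem_set Uz))).
  + rewrite -subset0 => y' [[My' _] [z Bz zy]].
    suff : (set_val @^-1` M `&` B) z by rewrite MB.
    by split => //=; rewrite zy.
Qed.

Lemma meagre_preimage_val A :
  meagre A -> meagre (set_val @^-1` A : set (set_type U)).
Proof.
move=> [F ndF ->]; rewrite preimage_bigcup.
exists (fun n => set_val @^-1` F n) => // n.
exact: nowhere_dense_preimage_val.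
Qed.

Lemma meagre_image_val (B : set (set_type U)) :
  meagre B -> meagre (set_val @` B).
Proof.
move=> [F ndF ->]; rewrite image_bigcup.
exists (fun n => set_val @` F n) => // n.
exact: nowhere_dense_image_val.
Qed.

End open_subspace.

(** * Separation by clopen sets in Stonean spaces *)

Section stonean_spaces.
Context (K : topologicalType).
Hypothesis hK : stonean K.
Implicit Types F O U V : set K.

Lemma clopen_closure U : open U -> clopen (closure U).
Proof. by move=> oU; split; [case: hK => _ _; apply|exact: closed_closure]. Qed.

(** Normality interposes an open [C] around [F] with [closure C] inside [O], and in a Stonean space
    [closure C] is clopen. *)
Lemma clopen_between F O : closed F -> open O -> F `<=` O ->
  exists V, [/\ clopen V, F `<=` V & V `<=` O].
Proof.
move=> cF oO FO; case: (hK) => cptK hausK _.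
have FO' : set_nbhs F O by apply/set_nbhsP; exists O; split.
have [B /set_nbhsP[C [oC FC CB]] BO] := compact_normal hausK cptK cF FO'.
exists (closure C); split; first exact: clopen_closure.
  exact: subset_trans FC (@subset_closure _ C).
exact: subset_trans (closureS CB) BO.
Qed.

Lemma clopen_nbhs x O : open O -> O x ->
  exists V, [/\ clopen V, V x & V `<=` O].
Proof.
move=> oO Ox; have [|||V [cV xV VO]] := @clopen_between [set x] O.
- apply: accessible_closed_set1; apply: hausdorff_accessible.
  by case: hK.
- by [].
- by move=> _ ->.
- by exists V; split => //; exact: xV.
Qed.

End stonean_spaces.

(** * The measure generated by a content on clopen sets *)

Section category_measure.
Local Open Scope ereal_scope.
Context (R : realType) (K : topologicalType) (x0 : K).
Hypothesis hK : stonean K.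
Variable m : set K -> \bar R.
Hypothesis m_ge0 : forall A, 0 <= m A.
Hypothesis mU : forall A B, A `&` B = set0 -> m (A `|` B) = m A + m B.
Hypothesis m_fin : m setT < +oo.

Let m_le A B : A `<=` B -> m A <= m B.
Proof.
move=> AB; rewrite -(setDUK AB) mU ?leeDl//.
by rewrite setDE setICA setICr setI0.
Qed.

Let m0 : m set0 = 0.
Proof.
have : m set0 \is a fin_num.
  by rewrite ge0_fin_numE//; apply: le_lt_trans m_fin; exact: m_le.
have := mU (setI0 set0); rewrite setU0; case: (m set0) => // r [rr] _.
by congr _%:E; lra.
Qed.

Let m_subadd (C : (set K)^nat) n :
  m (\big[setU/set0]_(k < n) C k) <= \sum_(k < n) m (C k).
Proof.
elim: n => [|n IHn]; first by rewrite !big_ord0 m0.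
rewrite !big_ord_recr/=; set B := \big[_/_]_(k < n) C k.
have -> : B `|` C n = B `|` (C n `\` B) 
  by apply/seteqP; split=> x /=; have [|] := pselect (B x); tauto.
rewrite mU; first by apply: leeD => //; exact: m_le.
by rewrite setDE setICA setICr setI0.
Qed.

(* All subsets are measurable here: only the outer measure is of interest. *)
Let discrete := g_sigma_algebraType [set: set (pointed_at x0)].

(* The outer measure generated by this content takes the infimum of
   [sum_k m (C_k)] over the clopen covers of [A] up to a meagre set. *)
Definition category_content (A : set discrete) : \bar R :=
  if `[< meagre (A : set K) >] then 0
  else if `[< clopen (A : set K) >] then m A else +oo.
Local Notation mu := category_content.

Let mu_ge0 A : 0 <= mu A.
Proof. by rewrite /mu; case: ifP => // _; case: ifP. Qed.

Let mu0 : mu set0 = 0.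
Proof.
rewrite /mu asboolT//; apply: nowhere_dense_meagre.
by rewrite /nowhere_dense closure0 interior0.
Qed.

Definition category_outer : set discrete -> \bar R := mu_ext mu.
Local Notation nu := category_outer.

HB.instance Definition _ := isOuterMeasure.Build R discrete nu
  (mu_ext0 mu0 mu_ge0) (mu_ext_ge0 mu_ge0) (le_mu_ext mu)
  (mu_ext_sigma_subadditive mu_ge0).

Lemma category_outer_le A : nu A <= mu A.
Proof.
apply: ereal_inf_lbound; exists (fun k => if k is 0%N then A else set0).
  split=> [i|x Ax]; last by exists 0%N.
  exact: sub_sigma_algebra.
by rewrite nneseries_recl// eseries0 ?adde0// => -[|k].
Qed.

Lemma category_outer_meagre A : meagre (A : set K) -> nu A = 0.
Proof.
move=> mA; apply/eqP; rewrite eq_le outer_measure_ge0 andbT.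
by apply: le_trans (category_outer_le A) _; rewrite /mu asboolT.
Qed.

Lemma category_outer_clopen A : clopen (A : set K) -> nu A <= m A.
Proof.
move=> cA; apply: le_trans (category_outer_le A) _.
by rewrite /mu; case: ifP => // _; rewrite asboolT.
Qed.

(** Cutting each piece of a cover by [C] and by its complement keeps meagre pieces meagre and clopen
    pieces clopen, and by additivity of [m] does not raise the total cost. *)
Lemma caratheodory_clopen C : clopen (C : set K) -> nu.-caratheodory C.
Proof.
move=> cC; apply: le_caratheodory_measurable => X.
apply: le_ereal_inf_tmp => _ [A [_ XA] <-].
apply: (@le_trans _ _ (\sum_(k <oo) mu (A k `&` C) +
                       \sum_(k <oo) mu (A k `&` ~` C))).
  apply: leeD; apply: ereal_inf_lbound.
    exists (fun k => A k `&` C) => //; split => [i|].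
      exact: sub_sigma_algebra.
    by rewrite -setI_bigcupl; exact: setSI.
  exists (fun k => A k `&` ~` C) => //; split => [i|].
    exact: sub_sigma_algebra.
  by rewrite -setI_bigcupl; exact: setSI.
rewrite -nneseriesD//; apply: lee_nneseries => [k _ _|k _].
  exact: adde_ge0.
rewrite /mu; have [mA|nmA] := pselect (meagre (A k : set K)).
  by rewrite !asboolT ?adde0//; apply: meagreS mA; exact: subIsetl.
rewrite [in leRHS](asboolF nmA).
have [cA|ncA] := pselect (clopen (A k : set K)); last first.
  by rewrite [in leRHS](asboolF ncA) leey.
rewrite [in leRHS](asboolT cA).
have -> : m (A k) = m (A k `&` C) + m (A k `&` ~` C).
  rewrite -mU ?setIUCr//; first by rewrite -setIUr setUCr setIT.
  by rewrite setIACA setICr setI0.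
have ifle b B : clopen (B : set K) ->
    (if b then 0 else if `[< clopen (B : set K) >] then m B else +oo) <= m B.
  by move=> cB; case: b => //; rewrite asboolT.
apply: leeD; apply: ifle; apply: clopenI => //.
exact: (@clopenC _ C).
Qed.

Lemma caratheodory_null A : nu A = 0 -> nu.-caratheodory A.
Proof.
move=> A0; apply: le_caratheodory_measurable => X.
have XA0 : nu (X `&` A) = 0.
  apply/eqP; rewrite eq_le outer_measure_ge0 andbT -A0.
  by apply: le_outer_measure; exact: subIsetr.
by rewrite [X in X + _ <= _]XA0 add0e; apply: le_outer_measure; exact: subIsetl.
Qed.

(** An open set is its clopen closure minus its boundary, and the boundary is nowhere dense, hence
    null. *)
Lemma caratheodory_borel (A : set (borel x0)) :
  measurable A -> nu.-caratheodory A.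
Proof.
have sG := @sigma_algebra_measurable _ (caratheodory_type nu).
apply: smallest_sub; first exact: sG.
move=> O oO /=.
have -> : O = closure O `\` (closure O `\` O).
  by rewrite setDD setIidr//; exact: subset_closure.
apply: caratheodory_measurable_setD.
  by apply: caratheodory_clopen; exact: clopen_closure.
apply: caratheodory_null; apply: category_outer_meagre.
by apply: nowhere_dense_meagre; exact: nowhere_dense_closureD.
Qed.

(** [CC] stands for a class of the three-star property, carried over to [K]; the two closure
    assumptions on it are (b) and (c). *)
Lemma category_outer_ge (CC : set (set K)) (c : \bar R) V :
  (forall F, CC F -> c <= m F) ->
  (forall U : (set K)^nat, (forall n, open (U n)) -> nondecreasing_seq U ->
     CC (\bigcup_n U n) -> exists n, CC (U n)) ->
  (forall U W, CC U -> open W -> meagre (U `+` W) -> CC W) ->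
  CC V -> open V -> c <= nu V.
Proof.
move=> cm CCup CCmeagre CCV oV; apply: le_ereal_inf_tmp => _ [A [_ VA] <-].
have [[k muAk]|nmu] := pselect (exists k, mu (A k) = +oo).
  rewrite (eseries_pinfty _ _ muAk) ?leey// => n _.
  by rewrite -ltNye (lt_le_trans _ (mu_ge0 _)).
(* Every piece now has finite cost, so it is meagre or clopen. Emptying the meagre ones leaves
   clopen sets of the same costs, since [m set0 = 0]. *)
pose C k : set K := if `[< meagre (A k : set K) >] then set0 else A k.
have cC k : clopen (C k) /\ m (C k) = mu (A k).
  rewrite /C /mu; case: asboolP => mA.
    by split; [exact: clopen0|exact: m0].
  case: asboolP => // cA; exfalso; apply: nmu; exists k.
  by rewrite /mu !asboolF.
pose U n := V `&` \big[setU/set0]_(k < n) C k.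
have oU n : open (U n).
  apply: openI => //; elim/big_ind : _ => //; first exact: open0.
    exact: openU.
  by move=> i _; have [[]] := cC i.
have ndU : nondecreasing_seq U.
  by move=> n p np; apply/subsetPset; apply: setIS; exact: subset_bigsetU.
have [|n CCUn] := CCup U oU ndU.
  apply: CCmeagre CCV _ _.
    by apply: bigcup_open => n _; exact: oU.
  (* Points of [V] missed by all [C k] lie in the discarded meagre pieces. *)
  apply: (@meagreS _ _ (\bigcup_k
    (if `[< meagre (A k : set K) >] then A k else set0))).
    move=> x [[Vx nUx]|[[n _ [Vx _]] //]].
    have [k _ Akx] := VA _ Vx; exists k => //; case: asboolP => // nmA.
    exfalso; apply: nUx; exists k.+1 => //; split => //.
    by rewrite big_ord_recr/=; right; rewrite /C asboolF.
  apply: meagre_bigcup => k; case: asboolP => // _.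
  by apply: nowhere_dense_meagre; rewrite /nowhere_dense closure0 interior0.
apply: le_trans (cm _ CCUn) _; apply: le_trans (m_le (@subIsetr _ _ _)) _.
apply: le_trans (m_subadd _ _) _.
rewrite (eq_bigr (fun k : 'I_n => mu (A k))); last first.
  by move=> k _; exact: (cC k).2.
by rewrite -(big_mkord xpredT (fun k => mu (A k))); apply: nneseries_lim_ge.
Qed.

Definition category_measure (A : set (borel x0)) : \bar R := nu A.

Let cm0 : category_measure set0 = 0.
Proof. exact: outer_measure0. Qed.

Let cm_ge0 A : 0 <= category_measure A.
Proof. exact: outer_measure_ge0. Qed.

Let cm_sigma_additive : semi_sigma_additive category_measure.
Proof.
move=> F mF tF mUF.
apply: (@caratheodory_measure_sigma_additive R discrete nu F) => //.
  by move=> n; exact: (caratheodory_borel (mF n)).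
exact: (caratheodory_borel mUF).
Qed.

HB.instance Definition _ := isMeasure.Build _ (borel x0) R category_measure
  cm0 cm_ge0 cm_sigma_additive.

Let cm_fin : fin_num_fun category_measure.
Proof.
apply: lty_fin_num_fun; apply: le_lt_trans m_fin.
exact: category_outer_clopen clopenT.
Qed.

HB.instance Definition _ := @Measure_isFinite.Build _ (borel x0) R
  category_measure cm_fin.

Lemma category_measure_exists :
  exists nu : {finite_measure set (borel x0) -> \bar R},
    [/\ forall A : set K, meagre A -> nu A = 0,
        forall A : set K, clopen A -> nu A <= m A &
        forall (CC : set (set K)) (c : \bar R) V,
          (forall F, CC F -> c <= m F) ->
          (forall U : (set K)^nat, (forall n, open (U n)) ->
             nondecreasing_seq U -> CC (\bigcup_n U n) ->
             exists n, CC (U n)) ->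
          (forall U W, CC U -> open W -> meagre (U `+` W) -> CC W) ->
          CC V -> open V -> c <= nu V].
Proof.
exists category_measure; split.
- exact: category_outer_meagre.
- exact: category_outer_clopen.
- exact: category_outer_ge.
Qed.

End category_measure.

(** * Charges and integrals *)

Section charge_parts.
Context d (T : measurableType d) (R : realType) (mu : {charge set T -> \bar R}).
Local Open Scope ereal_scope.

Lemma charge_parts_hahn : exists P N, [/\ measurable P, measurable N,
  forall A, measurable A -> charge_pos_part mu A = mu (A `&` P) &
  forall A, measurable A -> charge_neg_part mu A = - mu (A `&` N)].
Proof.
rewrite /charge_pos_part /charge_neg_part.
case: cid => -[P N] /= PN; exists P, N.
have [[mP _] [mN _] _ _] := PN; split=> // A mA.
  by rewrite jordan_posE cjordan_posE /crestr0 mem_set.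
by rewrite jordan_negE cjordan_negE /crestr0 mem_set.
Qed.

Lemma charge_total_variationE A :
  charge_total_variation mu A = charge_pos_part mu A + charge_neg_part mu A.
Proof. by []. Qed.

Lemma charge_parts_sub A : measurable A ->
  mu A = charge_pos_part mu A - charge_neg_part mu A.
Proof.
move=> mA; rewrite (jordan_decomp (projT2 (cid (hahn_exists mu))) mA).
by rewrite /cadd /= cscaleN1.
Qed.

End charge_parts.

Section nonnegative_charge.
Context d (T : measurableType d) (R : realType).
Variable nu : {finite_measure set T -> \bar R}.
Local Open Scope ereal_scope.

Let nuc : {charge set T -> \bar R} := charge_of_finite_measure nu.

Lemma charge_neg_part_measure A : measurable A -> charge_neg_part nuc A = 0.
Proof.
move=> mA; apply/eqP; rewrite eq_le measure_ge0 andbT.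
have [P [N [mP mN _ ->//]]] := charge_parts_hahn nuc.
by rewrite leeNl oppe0; exact: measure_ge0.
Qed.

Lemma charge_pos_part_measure A : measurable A -> charge_pos_part nuc A = nu A.
Proof.
move=> mA; have := charge_parts_sub nuc mA.
by rewrite charge_neg_part_measure// sube0.
Qed.

Lemma charge_total_variation_measure A : measurable A ->
  charge_total_variation nuc A = nu A.
Proof.
move=> mA; rewrite charge_total_variationE charge_neg_part_measure// adde0.
exact: charge_pos_part_measure.
Qed.

End nonnegative_charge.

Section integral_bound.
Context d (T : measurableType d) (R : realType).
Variable nu : {finite_measure set T -> \bar R}.

(** Pointwise, [f] is at most [e] plus [M] times the indicator of the set where [e <= f]. *)
Lemma Rintegral_le_split (f : T -> R) (e M : R) (d' : \bar R) :
  measurable_fun setT f -> 0 <= e -> 0 <= M ->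
  (forall x, 0 <= f x <= M) ->
  (nu [set x | (e <= f x)%R] <= d')%E ->
  ((Rintegral nu setT f)%:E <= e%:E * nu setT + M%:E * d')%E.
Proof.
move=> mf e0 M0 fM nud.
pose B := [set x | e <= f x].
have mB : measurable B.
  rewrite (_ : B = f @^-1` `[e, +oo[%classic).
    by rewrite -[X in measurable X]setTI; apply: mf.
  by apply/seteqP; split=> x /=; rewrite in_itv/= andbT.
have mf' : measurable_fun setT (fun x => (f x)%:E) by exact/measurable_EFinP.
have mI : measurable_fun setT (fun x => (\1_B x : R)%:E).
  exact/measurable_EFinP/measurable_indic.
have mMI : measurable_fun setT (fun x => M%:E * (\1_B x)%:E)%E.
  exact: measurable_funeM.
have I0 x : (0 <= (\1_B x : R)%:E)%E by rewrite lee_fin indicE.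
have f0 x : (0 <= (f x)%:E)%E by rewrite lee_fin; case/andP: (fM x).
have le_int : (\int[nu]_x (f x)%:E <= \int[nu]_x (e%:E + M%:E * (\1_B x)%:E))%E.
  apply: ge0_le_integral => //.
    by apply: emeasurable_funD => //; exact: measurable_cst.
  move=> x _; rewrite -EFinM -EFinD lee_fin indicE.
  have /andP[_ fxM] := fM x.
  have [xB|xB] := boolP (x \in B).
    by rewrite mulr1; apply: le_trans fxM _; rewrite lerDr.
  rewrite mulr0 addr0 ltW// ltNge; apply: contra xB => xB.
  exact/mem_set.
move: le_int; rewrite ge0_integralD//=; last first.
  by move=> x _; exact: mule_ge0.
rewrite integral_cst// ge0_integralZl_EFin// integral_indic// setIT => le_int.
have le_d : (M%:E * nu B <= M%:E * d')%E by exact: lee_wpmul2l.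
have fin_int : (\int[nu]_x (f x)%:E)%E \is a fin_num.
  rewrite ge0_fin_numE; last exact: integral_ge0.
  apply: le_lt_trans le_int _.
  rewrite ltey_eq; apply/orP; left.
  by rewrite fin_numD !fin_numM// fin_num_measure.
rewrite /Rintegral fineK//; apply: le_trans le_int _.
exact: leeD.
Qed.

End integral_bound.

(** * Normality of strictly positive category measures *)

Section borel_sets.
Context (K : topologicalType) (x0 : K).

Lemma open_borel (O : set K) : open O -> measurable (O : set (borel x0)).
Proof. by move=> oO; exact: sub_sigma_algebra. Qed.

Lemma closed_borel (F : set K) : closed F -> measurable (F : set (borel x0)).
Proof.
move=> cF; rewrite -(setCK F); apply: measurableC; apply: open_borel.
exact: closed_openC.
Qed.

Lemma continuous_borel (R : realType) (f : K -> R) : continuous f ->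
  measurable_fun setT (f : borel x0 -> R).
Proof.
move=> /continuousP cf; apply: (measurability _ (RGenOpens.measurableE R)).
move=> _ /= [_ [a [b ->]] <-]; rewrite setTI; apply: open_borel; apply: cf.
exact: interval_open.
Qed.

End borel_sets.

Definition directed_up (T : Type) (D : set (set T)) :=
  D !=set0 /\ forall A B, D A -> D B -> exists2 C, D C & A `|` B `<=` C.

Lemma directed_up_bigsetU (T : Type) (D : set (set T)) (O : nat -> set T) n :
  directed_up D -> (forall i, D (O i)) ->
  exists2 A, D A & \big[setU/set0]_(i < n) O i `<=` A.
Proof.
move=> [[A0 DA0] Ddir] DO; elim: n => [|n [A DA OA]].
  by exists A0 => //; rewrite big_ord0.
have [B DB AB] := Ddir _ _ DA (DO n); exists B => //.
rewrite big_ord_recr/=; apply: subset_trans AB.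
by apply: setSU.
Qed.

(** * Continuous functions and clopen step functions *)

Section continuous_functions.
Context (R : realType) (K : topologicalType).

Definition clopen_step (V : set K) (e : R) (x : K) : R := e * \1_V x.

Lemma clopen_step_continuous (V : set K) (e : R) :
  clopen V -> continuous (clopen_step V e).
Proof.
move=> [oV cV] x; have [Vx|nVx] := pselect (V x).
  apply: cvg_near_cst; have : \forall y \near x, V y by apply: open_nbhs_nbhs.
  by apply: filterS => y Vy; rewrite /clopen_step !indicE !mem_set.
apply: cvg_near_cst; have : \forall y \near x, (~` V) y.
  by apply: open_nbhs_nbhs; split => //; exact: closed_openC.
by apply: filterS => y nVy; rewrite /clopen_step !indicE !memNset.
Qed.

Lemma open_lt_continuous (f : K -> R) (e : R) :
  continuous f -> open [set x | f x < e].
Proof. by move=> /continuousP cf; exact: (cf _ (@open_lt _ e)). Qed.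

Lemma continuous_ubound (f : K -> R) :
  compact [set: K] -> continuous f -> exists2 M, 0 < M & forall x, f x <= M.
Proof.
move=> cptK cf.
have /compact_bounded : compact (f @` setT).
  by apply: continuous_compact => //; exact: continuous_subspaceT.
move=> /ex_strict_bound_gt0[M M0 fM]; exists M => // x.
by apply: le_trans (ler_norm _) _; apply: ltW; apply: fM; exists x.
Qed.

(** If every member of [D] were at least [e] on a nonempty open set, then [e] times the indicator of
    a nonempty clopen subset would be a continuous lower bound of [D] that is positive somewhere. *)
Lemma has_inf0_nowhere_dense (D : set (continuousType K R)) (e : R) :
  stonean K -> Defs.has_inf0 D -> 0 < e ->
  nowhere_dense (~` \bigcup_(f in D) [set x | f x < e]).
Proof.
move=> hK [D0 Dinf] e0; apply/nowhere_denseP => W oW [x Wx].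
apply: contrapT => noW'.
have [V [cV Vx VW]] := clopen_nbhs hK oW Wx.
have WD y : W y -> forall f, D f -> e <= f y.
  move=> Wy f Df; rewrite leNgt; apply/negP => fye; apply: noW'.
  exists (W `&` [set z | f z < e]); split.
  - by apply: openI => //; apply: open_lt_continuous; exact: cts_fun.
  - by exists y.
  - exact: subIsetl.
  - by rewrite -subset0 => z [[Wz fz]]; apply; exists f.
pose g : continuousType K R := mkcts (clopen_step_continuous (e := e) cV).
have gE y : g y = e * (y \in V)%:R by rewrite -indicE.
have : g x <= 0.
  apply: Dinf => f Df y; rewrite gE.
  have [/set_mem Vy|nVy] := boolP (y \in V).
    by rewrite mulr1; apply: WD => //; exact: VW.
  by rewrite mulr0; exact: D0.
by rewrite gE mem_set// mulr1 leNgt e0.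
Qed.

End continuous_functions.

Section strictly_positive_normal_measure.
Context (R : realType) (K : topologicalType) (x0 : K).
Hypothesis hK : stonean K.
Variable nu : {finite_measure set (borel x0) -> \bar R}.
Variable U : set K.
Hypothesis nu_meagre : forall A : set K, meagre A -> nu A = 0%E.
Hypothesis oU : open U.
Hypothesis nuU : nu (~` U) = 0%E.
Hypothesis nu_pos : forall V : set K, open V -> V `&` U !=set0 -> (0 < nu V)%E.

Let v (A : set K) := fine (nu A).

Let vE (A : set K) : measurable (A : set (borel x0)) -> nu A = (v A)%:E.
Proof. by move=> mA; rewrite fineK// fin_num_measure. Qed.

Let v_ge0 A : 0 <= v A.
Proof. exact: fine_ge0. Qed.

Let v_le (A B : set K) : measurable (A : set (borel x0)) ->
  measurable (B : set (borel x0)) -> A `<=` B -> v A <= v B.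
Proof. by move=> mA mB AB; rewrite -lee_fin -!vE// le_measure// in_setE. Qed.

Let vDI (A B : set K) : measurable (A : set (borel x0)) ->
  measurable (B : set (borel x0)) -> v A = v (A `\` B) + v (A `&` B).
Proof.
move=> mA mB; apply: EFin_inj; rewrite EFinD -!vE//; first exact: measureDI.
- exact: measurableI.
- exact: measurableD.
Qed.

Let vU (A B : set K) : measurable (A : set (borel x0)) ->
  measurable (B : set (borel x0)) -> v (A `|` B) <= v A + v B.
Proof.
move=> mA mB; rewrite -lee_fin EFinD -!vE//; last exact: measurableU.
exact: measureU2.
Qed.

Let small_inv (d : R) : 0 < d -> exists i : nat, i.+1%:R^-1 < d.
Proof.
move=> d0; have [N _ hN] := near_infty_natSinv_lt (PosNum d0).
by exists N; exact: (hN N (leqnn N)).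
Qed.

(* A countable subfamily whose union [W] has maximal measure leaves out only
   null open parts of the members of [D] outside [closure W]; by strict
   positivity these do not meet [U]. *)
Lemma directed_exhaustion (D : set (set K)) (e : R) :
  directed_up D -> (forall O, D O -> open O) -> 0 < e ->
  exists2 O, D O & (nu ((\bigcup_(A in D) A) `\` O) < e%:E)%E.
Proof.
move=> Ddir Dopen e0; have [[V0 DV0] _] := Ddir.
have mD O : D O -> measurable (O : set (borel x0)).
  by move=> /Dopen; exact: open_borel.
pose S := [set v O | O in D].
have S_sup : has_sup S.
  split; first by exists (v V0), V0.
  by exists (v setT) => _ [V DV <-]; apply: v_le => //; exact: mD.
pose s := sup S.
have le_s O : D O -> v O <= s.
  by move=> DO; apply: ub_le_sup; [exact: S_sup.2|exists O].
have /choice[ O OP] i : exists O, D O /\ s - i.+1%:R^-1 < v O.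
  have i0 : 0 < i.+1%:R^-1 :> R by rewrite invr_gt0.
  have [_ [V DV <-] sO] := sup_adherent i0 S_sup.
  by exists V.
pose W := \bigcup_i O i.
have oW : open W by apply: bigcup_open => i _; exact: Dopen (OP i).1.
have mW : measurable (W : set (borel x0)) by exact: open_borel.
(* Directedness puts every finite union of the [O i] inside a member of [D], so its measure is at
   most [s]; continuity from below passes this to [W]. *)
have vW : v W <= s.
  pose B n := \big[setU/set0]_(i < n.+1) O i.
  have mB n : measurable (B n : set (borel x0)).
    by apply: bigsetU_measurable => i _; apply: mD; exact: (OP _).1.
  have UB : \bigcup_n B n = W by apply: bigcup_bigsetU_bigcup.
  have ndB : nondecreasing_seq B.
    by move=> n m nm; apply/subsetPset; exact: subset_bigsetU.
  have mUB : measurable (\bigcup_n B n : set (borel x0)) by rewrite UB.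
  have cvB : nu \o B @ \oo --> nu W.
    by rewrite -UB; apply: (@nondecreasing_cvg_mu _ (borel x0) R nu B).
  rewrite -lee_fin -vE//; rewrite -(cvg_lim _ cvB)//.
  apply: lime_le; first by apply/cvg_ex; exists (nu W).
  apply: nearW => n /=.
  have [A DA BA] := directed_up_bigsetU n.+1 Ddir (fun i => (OP i).1).
  rewrite vE// lee_fin; apply: le_trans (le_s _ DA).
  by apply: v_le => //; exact: mD.
(* A member [C] of [D] above both [A] and [O i] has measure at most [s], while [O i] has measure
   above [s - 1/(i+1)]; hence [A] exceeds [O i] by less than [1/(i+1)]. *)
have DW A : D A -> v (A `\` W) = 0.
  move=> DA; apply/eqP; rewrite eq_le v_ge0 andbT.
  suff h (d : R) : 0 < d -> v (A `\` W) <= d.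
    by apply/ler_addgt0Pl => d d0; rewrite addr0; exact: h.
  move=> d0.
  have [i id] := small_inv d0.
  have [C DC AOC] := Ddir.2 _ _ DA (OP i).1.
  have mAW : measurable (A `\` W : set (borel x0)).
    by apply: measurableD => //; exact: mD.
  have : v (A `\` W) <= v (C `\` O i).
    apply: v_le => //.
      by apply: measurableD; [exact: mD|exact: mD (OP i).1].
    move=> x [Ax nWx]; split; first by apply: AOC; left.
    by move=> Oix; apply: nWx; exists i.
  have := vDI (mD _ DC) (mD _ (OP i).1).
  have -> : C `&` O i = O i.
    by apply/setIidPr => x Ox; apply: AOC; right.
  have := le_s _ DC; move: (OP i).2 id; move: (i.+1%:R^-1) => r.
  move=> h1 h2 h3 h4 h5; lra.
have DcW : \bigcup_(A in D) A `<=` closure W `|` ~` U.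
  move=> x [A DA Ax]; have [|ncWx] := pselect (closure W x); first by left.
  right => Ux; have oAW : open (A `\` closure W).
    apply: openI; first exact: Dopen.
    by apply: closed_openC; exact: closed_closure.
  have := nu_pos oAW; rewrite ltNge => /(_ _)/negP; apply.
    by exists x.
  rewrite vE; last exact: open_borel.
  rewrite lee_fin -(DW _ DA); apply: v_le; first exact: open_borel.
    by apply: measurableD => //; exact: mD.
  by apply: setDS; exact: subset_closure.
have [i ie] := small_inv e0.
have DOi := (OP i).1; exists (O i) => //.
have mN : measurable (closure W `\` W : set (borel x0)).
  by apply: measurableD => //; apply: closed_borel; exact: closed_closure.
have mUc : measurable (~` U : set (borel x0)).
  by apply: measurableC; exact: open_borel.
have mWO : measurable (W `\` O i : set (borel x0)).
  by apply: measurableD => //; exact: mD.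
have mDO : measurable ((\bigcup_(A in D) A) `\` O i : set (borel x0)).
  by apply: measurableD; [apply: open_borel; exact: bigcup_open|exact: mD].
rewrite vE// lte_fin.
(* What [O i] leaves out lies in the boundary of [W] or outside [U], both null, or in [W], where the
   loss is below [1/(i+1)]. *)
apply: (@le_lt_trans _ _ (v (closure W `\` W) + v (~` U) + v (W `\` O i))).
  apply: (@le_trans _ _ (v ((closure W `\` W) `|` ~` U `|` (W `\` O i)))).
    apply: v_le => //.
      by apply: measurableU => //; exact: measurableU.
    move=> x [/DcW cx nOx]; have [Wx|nWx] := pselect (W x); first by right.
    by left; case: cx; [left|right].
  apply: le_trans (vU _ _) _ => //; first exact: measurableU.
  by rewrite lerD2r; exact: vU.
have -> : v (closure W `\` W) = 0.
  rewrite /v nu_meagre//.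
  by apply: nowhere_dense_meagre; exact: nowhere_dense_closureD.
have -> : v (~` U) = 0 by rewrite /v nuU.
have := vDI mW (mD _ DOi).
have -> : W `&` O i = O i by apply/setIidPr => x Ox; exists i.
move: (OP i).2 ie vW; move: (i.+1%:R^-1) => r.
move=> h1 h2 h3 h4; lra.
Qed.

Let nuc : {charge set (borel x0) -> \bar R} := charge_of_finite_measure nu.

(** Closed inner sets make the condition symmetric under complements, so that the approximable sets
    form a sigma-algebra; these inner sets are compact because [K] is. *)
Let approximable (A : set (borel x0)) := forall e : R, 0 < e ->
  exists F O : set K, [/\ closed F, open O, F `<=` A, A `<=` O &
    (nu (O `\` F) < e%:E)%E].

(** The clopen subsets of [O] are directed and have union [O], so exhaustion finds one that fills
    [O] up to [e]. *)
Let approximable_open (O : set K) : open O -> approximable O.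
Proof.
move=> oO e e0; pose D := [set V : set K | clopen V /\ V `<=` O].
have [|||V [[oV cV] VO] nuV] := @directed_exhaustion D e.
- split; first by exists set0; split => //; exact: clopen0.
  move=> A B [cA AO] [cB BO]; exists (A `|` B) => //; split.
    exact: clopenU.
  by move=> x [/AO|/BO].
- by move=> A [[]].
- exact: e0.
- exists V, O; split => //; move: nuV; congr (nu (_ `\` _) < _)%E.
  apply/seteqP; split=> x; first by move=> [A [_ AO]] /AO.
  by move=> Ox; have [A [cA Ax AO]] := clopen_nbhs hK oO Ox; exists A.
Qed.

Let approximableC A : approximable A -> approximable (~` A).
Proof.
move=> aA e e0; have [F [ O [cF oO FA AO nuFO]]] := aA e e0.
exists (~` O), (~` F); split.
- exact: open_closedC.
- exact: closed_openC.
- exact: subsetC.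
- exact: subsetC.
- by rewrite setDE setCK setIC -setDE.
Qed.

Let approximable_bigcup (A : (set (borel x0))^nat) :
  (forall n, approximable (A n)) -> approximable (\bigcup_n A n).
Proof.
move=> aA e e0.
(* These errors add up to [e / 2], which leaves room for replacing the union of the closed sets by a
   finite one. *)
have e2 n : 0 < e / 2 / (2 ^ n.+1)%:R by rewrite !divr_gt0// ltr0n expn_gt0.
have /choice[G GP] n := aA n _ (e2 n).
have /choice[ O OP] := GP.
pose F n : set K := \big[setU/set0]_(i < n.+1) G i.
have oW : open (\bigcup_n O n) by apply: bigcup_open => n _; have [] := OP n.
have cG n : closed (G n) by have [] := OP n.
have cF n : closed (F n) by apply: closed_bigsetU => i _; exact: cG.
have mGb n : measurable (G n : set (borel x0)) by exact: closed_borel.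
have mF n : measurable (F n : set (borel x0)) by exact: closed_borel.
have mO n : measurable (O n : set (borel x0)).
  by apply: open_borel; have [] := OP n.
have mW : measurable (\bigcup_n O n : set (borel x0)) by exact: open_borel.
have UF : \bigcup_n F n = \bigcup_n G n by apply: bigcup_bigsetU_bigcup.
have mG : measurable (\bigcup_n G n : set (borel x0)).
  exact: bigcupT_measurable.
have WG : (nu (\bigcup_n O n `\` \bigcup_n G n) <= (e / 2)%:E)%E.
  apply: (@le_trans _ _ (\sum_(n <oo) nu (O n `\` G n))%E).
    apply: measure_sigma_subadditive.
    - by move=> n; exact: measurableD.
    - exact: measurableD.
    - move=> x [[n _ Onx] nG]; exists n => //; split=> // Gnx.
      by apply: nG; exists n.
  apply: le_trans (epsilon_trick0 xpredT (ltW _)); last by rewrite divr_gt0.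
  apply: lee_nneseries => // n _; apply: ltW.
  by have [] := OP n.
have cvF : nu \o (fun n => \bigcup_n O n `\` F n) @ \oo -->
    nu (\bigcup_n O n `\` \bigcup_n G n).
  rewrite -UF setDE setC_bigcup -bigcapIr; last by exists 0%N.
  apply: (@nonincreasing_cvg_mu _ (borel x0) R nu
    (fun n => \bigcup_n O n `&` ~` F n)).
  - rewrite ltey_eq fin_num_measure//; apply: measurableI => //.
    exact: measurableC.
  - by move=> n; apply: measurableI => //; exact: measurableC.
  - apply: bigcapT_measurable => n; apply: measurableI => //.
    exact: measurableC.
  - move=> n m nm; apply/subsetPset; apply: setIS; apply: subsetC.
    exact: subset_bigsetU.
have lte : (nu (\bigcup_n O n `\` \bigcup_n G n) < e%:E)%E.
  apply: le_lt_trans WG _; rewrite lte_fin; lra.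
have [[n nue]|nnue] :=
    pselect (exists n, (nu (\bigcup_n O n `\` F n) < e%:E)%E).
  exists (F n), (\bigcup_n O n); split => //.
  - move=> x; rewrite /F -bigcup_mkord => -[k _ Gkx]; exists k => //.
    by have [_ _ GA _ _] := OP k; exact: GA.
  - move=> x [k _ Akx]; exists k => //.
    by have [_ _ _ AO _] := OP k; exact: AO.
exfalso; move: lte; rewrite ltNge => /negP; apply.
rewrite -(cvg_lim _ cvF)//; apply: lime_ge.
  by apply/cvg_ex; exists (nu (\bigcup_n O n `\` \bigcup_n G n)).
apply: nearW => n; rewrite leNgt; apply/negP => nue; apply: nnue.
by exists n.
Qed.

Lemma finite_measure_regular : regular_charge nuc.
Proof.
move=> A e mA e0; have [_ cptF _] := hK.
have aA : approximable A.
  move: mA; apply: smallest_sub; last exact: approximable_open.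
  split.
  - by apply: approximable_open; exact: open0.
  - by move=> B /approximableC; rewrite setTD.
  - exact: approximable_bigcup.
have [F [ O [cF oO FA AO nuFO]]] := aA e e0; exists F, O; split => //.
  by case: hK => cptK _ _; apply: (subclosed_compact cF cptK).
rewrite charge_total_variation_measure//.
by apply: measurableD; [exact: open_borel|exact: closed_borel].
Qed.

(** The open sets [[set x | f x < e]] for [f] in [D] are directed and cover all but a nowhere dense
    set, so one of them, given by [f1], fills the space up to measure [d]. A member [h] of [D] below
    [f0] and [f1] is then less than [e] off a set of measure at most [d], and on that set the bound
    [M] of [f0] controls it. *)
Lemma finite_measure_order_continuous :
  order_continuous (fun f : continuousType K R => charge_integral nuc f).
Proof.
move=> D [[f0 Df0] Ddir] Dinf; have [D0 _] := Dinf; have [cptK _ _] := hK.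
suff small eta : 0 < eta ->
    exists2 h, D h & `|charge_integral nuc (h : borel x0 -> R)| <= eta.
  have Dphi0 : [set `|charge_integral nuc (f : borel x0 -> R)| |
      f in (D : set (continuousType K R))] !=set0.
    by exists `|charge_integral nuc (f0 : borel x0 -> R)|, f0.
  have lb0 : lbound [set `|charge_integral nuc (f : borel x0 -> R)| |
      f in (D : set (continuousType K R))] 0.
    by move=> _ [f _ <-].
  apply/eqP; rewrite eq_le; apply/andP; split; last exact: lb_le_inf.
  apply/ler_addgt0Pr => eta eta0; rewrite add0r.
  have [h Dh heta] := small _ eta0; apply: le_trans heta.
  by apply: ge_inf; [exists 0|exists h].
move=> eta0.
have [M M0 fM] := continuous_ubound cptK (@cts_fun _ _ f0).
pose N := v setT.
have N0 : 0 <= N by exact: v_ge0.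
(* These choices make [e * N + M * d] at most [eta]; the 1 in [1 + N] covers the case [N = 0]. *)
pose e := eta / 2 / (1 + N); pose d := eta / 2 / M.
have e0 : 0 < e by rewrite !divr_gt0// ltr_pwDl.
have d0 : 0 < d by rewrite !divr_gt0.
pose DD := [set [set x | (f : continuousType K R) x < e] | f in D].
have DDE : \bigcup_(A in DD) A = \bigcup_(f in D) [set x | f x < e].
  by rewrite bigcup_image.
have [|||_ [f1 Df1 <-] nuV] := @directed_exhaustion DD d.
- split; first by exists [set x | f0 x < e], f0.
  move=> _ _ [f Df <-] [g Dg <-]; have [h Dh hfg] := Ddir _ _ Df Dg.
  exists [set x | h x < e]; first by exists h.
  by move=> x [] /=; apply: le_lt_trans; have [] := hfg x.
- by move=> _ [f Df <-]; apply: open_lt_continuous; exact: cts_fun.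
- by [].
rewrite DDE in nuV.
have [h Dh hf] := Ddir _ _ Df0 Df1; exists h => //.
have h0M x : 0 <= h x <= M.
  by rewrite D0//=; apply: le_trans (fM x); have [] := hf x.
have mh : measurable_fun setT (h : borel x0 -> R).
  by apply: continuous_borel; exact: cts_fun.
have oWf f : D f -> open [set x | f x < e].
  by move=> Df; apply: open_lt_continuous; exact: cts_fun.
have nuB : (nu [set x | (e <= h x)%R] <= d%:E)%E.
  pose W := \bigcup_(f in D) [set x | f x < e].
  have oW : open W by apply: bigcup_open => f; exact: oWf.
  have mW : measurable (W : set (borel x0)) by exact: open_borel.
  have mf1 : measurable ([set x | f1 x < e] : set (borel x0)).
    by apply: open_borel; exact: oWf.
  have mB : measurable ([set x | e <= h x] : set (borel x0)).
    rewrite (_ : [set x | e <= h x] = ~` [set x | h x < e]).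
      by apply: measurableC; apply: open_borel; exact: oWf.
    by apply/seteqP; split => x /=; rewrite leNgt => /negP.
  apply: (@le_trans _ _ (nu (~` W `|` (W `\` [set x | f1 x < e])))).
    apply: le_measure; rewrite ?in_setE//.
      apply: measurableU; first exact: measurableC.
      exact: measurableD.
    move=> x /= ehx; have [Wx|nWx] := pselect (W x); last by left.
    right; split => //= f1x; move: ehx; rewrite leNgt => /negP; apply.
    by apply: le_lt_trans f1x; have [] := hf x.
  apply: le_trans (measureU2 _ _ _) _.
  - exact: measurableC.
  - exact: measurableD.
  rewrite [X in (X + _)%E](_ : _ = 0%E) ?add0e; first exact: ltW.
  apply: nu_meagre; apply: nowhere_dense_meagre.
  exact: has_inf0_nowhere_dense.
have mB : measurable ([set x | e <= h x] : set (borel x0)).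
  rewrite (_ : [set x | e <= h x] = ~` [set x | h x < e]).
    by apply: measurableC; apply: open_borel; exact: oWf.
  by apply/seteqP; split => x /=; rewrite leNgt => /negP.
have posle : Rintegral (charge_pos_part nuc) setT h <= eta.
  rewrite -lee_fin.
  apply: le_trans
    (Rintegral_le_split (e := e) (M := M) (d' := d%:E) mh _ _ h0M _) _.
  - exact: ltW.
  - exact: ltW.
  - by rewrite charge_pos_part_measure.
  rewrite charge_pos_part_measure// vE// -!EFinM -EFinD lee_fin.
  have -> : M * d = eta / 2 by rewrite /d mulrC divfK// gt_eqF.
  have : e * N <= eta / 2.
    rewrite /e mulrAC ler_pdivrMr ?ltr_pwDl// ler_wpM2l//.
      by rewrite divr_ge0// ltW.
    by rewrite lerDr.
  rewrite -/N; lra.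
have neg0 : Rintegral (charge_neg_part nuc) setT h = 0.
  apply/eqP; rewrite eq_le Rintegral_ge0 ?andbT; last first.
    by move=> x _; have /andP[] := h0M x.
  rewrite -lee_fin.
  apply: le_trans
    (Rintegral_le_split (e := e) (M := M) (d' := 0%E) mh _ _ h0M _) _.
  - exact: ltW.
  - exact: ltW.
  - by rewrite charge_neg_part_measure.
  by rewrite charge_neg_part_measure// !mule0 adde0.
rewrite /charge_integral neg0 subr0 ger0_norm//.
by apply: Rintegral_ge0 => x _; have /andP[] := h0M x.
Qed.

Lemma finite_measure_normal : normal_measure nuc.
Proof.
split; [exact: finite_measure_regular|exact: finite_measure_order_continuous].
Qed.

Lemma support_of_positive x : U x -> charge_support nuc x.
Proof.
move=> Ux V [oV Vx]; rewrite charge_total_variation_measure.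
  by apply: nu_pos => //; exists x.
exact: open_borel.
Qed.

End strictly_positive_normal_measure.

(** * Supports of normal measures *)

Section kelley_measure.
Context (R : realType).
Local Open Scope ereal_scope.

Lemma kelley_i_ge (X : Type) (n : nat) (F : 'I_n -> set X) x :
  (\sum_(j < n) (x \in F j : nat) <= kelley_i F)%N.
Proof.
pose J := [set j | x \in F j]%SET.
apply: (@leq_trans #|J|).
  rewrite -sum1_card [leqRHS]big_mkcond/=; apply: leq_sum => j _.
  by rewrite finset.inE; case: (x \in F j).
apply: (@leq_bigmax_cond _ (fun J : {set 'I_n} =>
  `[< \bigcap_(j in [set` J]) F j !=set0 >]) (fun J : {set 'I_n} => #|J|)).
by apply/asboolP; exists x => j /=; rewrite finset.inE => /set_mem.
Qed.

(** Integrates the pointwise bound on the sum of indicators. This is the easy converse of Kelley's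
    theorem: for a finite measure, a class of sets of measure bounded away from 0 has positive
    intersection number. *)
Lemma sum_measure_le_kelley_i d (T : measurableType d)
    (p : {measure set T -> \bar R}) (n : nat) (F : 'I_n -> set T) :
  (forall j, measurable (F j)) ->
  \sum_(j < n) p (F j) <= (kelley_i F)%:R%:E * p setT.
Proof.
move=> mF; rewrite -integral_cst//.
under eq_bigr => j _ do rewrite -[F j]setIT -integral_indic//.
have mI j : measurable_fun setT (fun x => (\1_(F j) x : R)%:E).
  exact/measurable_EFinP/measurable_indic.
have I0 j x : 0 <= (\1_(F j) x : R)%:E by rewrite lee_fin indicE.
rewrite -ge0_integral_sum//.
apply: ge0_le_integral => //.
- by move=> x _; apply: sume_ge0 => j _; exact: I0.
- exact: emeasurable_sum.
- move=> x _; rewrite sumEFin lee_fin.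
  under eq_bigr => j _ do rewrite indicE.
  by rewrite -natr_sum ler_nat; exact: kelley_i_ge.
Qed.

End kelley_measure.

(** * Null sets and support of a normal measure *)

Section normal_measure_support.
Context (R : realType) (K : topologicalType) (x0 : K).
Hypothesis hK : stonean K.
Variable mu : {charge set (borel x0) -> \bar R}.
Hypothesis mu_normal : normal_measure mu.
Local Open Scope ereal_scope.

Let tv := charge_total_variation mu.

Lemma charge_total_variation_fin (A : set (borel x0)) : measurable A ->
  tv A \is a fin_num.
Proof.
by move=> mA; rewrite /tv charge_total_variationE fin_numD !fin_num_measure.
Qed.

Lemma abse_le_total_variation (A : set (borel x0)) : measurable A ->
  `|mu A| <= tv A.
Proof. exact: abse_charge_variation. Qed.

Lemma charge_integral_step (V : set K) : clopen V ->
  (charge_integral mu (clopen_step V 1 : borel x0 -> R))%:E = mu V.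
Proof.
move=> [oV _]; have mV : measurable (V : set (borel x0)) by exact: open_borel.
have intE (p : {finite_measure set (borel x0) -> \bar R}) :
    Rintegral p setT (clopen_step V 1 : borel x0 -> R) = fine (p V).
  rewrite /Rintegral -[V in RHS]setIT -integral_indic//; congr fine.
  by apply: eq_integral => x _; rewrite /clopen_step mul1r.
rewrite /charge_integral !intE EFinB !fineK ?fin_num_measure//.
by rewrite -charge_parts_sub.
Qed.

(* The indicators of the clopen [V] with [F <= V <= O] decrease to 0. *)
Lemma normal_measure_closed_nowhere_dense (F : set K) :
  closed F -> nowhere_dense F -> mu F = 0.
Proof.
move=> cF ndF; have [reg oc] := mu_normal.
have mF : measurable (F : set (borel x0)) by exact: closed_borel.
suff small (e : R) : (0 < e)%R -> `|mu F| <= (e + e)%:E.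
  apply/eqP; rewrite -abse_eq0 eq_le abse_ge0 andbT.
  apply/lee_addgt0Pr => e e0; rewrite add0e [e]splitr.
  by apply: small; rewrite divr_gt0.
move=> e0; have [F' [ O [cptF' oO F'F FO tvO]]] := reg F e mF e0.
pose D := [set f : continuousType K R | exists V,
  [/\ clopen V, F `<=` V, V `<=` O & forall x, f x = clopen_step V 1 x]].
have stepD V : clopen V -> F `<=` V -> V `<=` O ->
    exists2 f : continuousType K R, D f & forall x, f x = clopen_step V 1 x.
  move=> cV FV VO; exists (mkcts (clopen_step_continuous (e := 1) cV)) => //.
  by exists V.
have stepE (V : set K) x : clopen_step V 1 x = ((x \in V)%:R)%R :> R.
  by rewrite /clopen_step mul1r indicE.
have Ddir : downward_directed D.
  split.
    have [V [cV FV VO]] := clopen_between hK cF oO FO.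
    by have [f Df _] := stepD V cV FV VO; exists f.
  move=> f g [V [cV FV VO fE]] [W [cW FW WO gE]].
  have [||| h Dh hE] := stepD (V `&` W).
  - exact: clopenI.
  - by move=> x Fx; split; [exact: FV|exact: FW].
  - by move=> x [/VO].
  exists h => // x; rewrite hE fE gE !stepE in_setI.
  by split; case: (x \in V); case: (x \in W); rewrite ?lexx ?ler01.
have Dinf : Defs.has_inf0 D.
  split=> [f [V [_ _ _ fE]] x|g gD x]; first by rewrite fE stepE.
  (* A continuous lower bound positive at [x] is positive at some [y] outside [F]; a clopen set
     between [F] and [O] that avoids [y] gives a member of [D] vanishing at [y]. *)
  rewrite leNgt; apply/negP => gx.
  have ogx : open [set y | (0 < g y)%R].
    have /continuousP cg := @cts_fun _ _ g; exact: (cg _ (@open_gt _ 0%R)).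
  have [W [oW [y Wy] Wg WF]] :=
    (nowhere_denseP F).1 ndF _ ogx (ex_intro _ x gx).
  have nFy : ~ F y by move=> Fy; have : (W `&` F) y by []; rewrite WF.
  have oOy : open (O `\` [set y]).
    apply: openI => //; apply: closed_openC; apply: accessible_closed_set1.
    by apply: hausdorff_accessible; case: hK.
  have FOy : F `<=` O `\` [set y].
    by move=> z Fz; split; [exact: FO|move=> zy; apply: nFy; rewrite -zy].
  have [V [cV FV VO]] := clopen_between hK cF oOy FOy.
  have [f Df fE] := stepD V cV FV (subset_trans VO (@subDsetl _ _ _)).
  have := gD f Df y; rewrite fE stepE memNset; last by move=> /VO[_]; apply.
  by apply/negP; rewrite -ltNge; exact: (Wg _ Wy).
(* By order continuity some clopen [V] has small charge; the part of [V] outside [F] lies in [O] and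
   outside [F'], so its charge is small too. *)
have [V [cV FV VO muV]] : exists V,
    [/\ clopen V, F `<=` V, V `<=` O & `|mu V| < e%:E].
  have inf0 := oc D Ddir Dinf.
  have [||r [f [V [cV FV VO fE]] <-] re] := @inf_lt _
      [set `|charge_integral mu (f : borel x0 -> R)|%R |
        f in (D : set (continuousType K R))] e.
  - have [[f Df] _] := Ddir.
    by exists `|charge_integral mu (f : borel x0 -> R)|%R, f.
  - by rewrite [X in (X < _)%R]inf0.
  - exists V; split => //; rewrite -charge_integral_step// abse_EFin lte_fin.
    by move: re; congr (`|charge_integral mu _| < _)%R; exact/funext.
have mV : measurable (V : set (borel x0)).
  by have [oV _] := cV; exact: open_borel.
have cF' : closed F' by apply: compact_closed => //; case: hK.
have mVF : measurable (V `\` F : set (borel x0)) by exact: measurableD.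
have muVF : `|mu (V `\` F)| < e%:E.
  apply: le_lt_trans (abse_le_total_variation mVF) (le_lt_trans _ tvO).
  apply: le_measure; rewrite ?in_setE//.
    by apply: measurableD; [exact: open_borel|exact: closed_borel].
  by apply: setDSS.
have : mu F \is a fin_num by exact: fin_num_measure.
have : mu (V `\` F) \is a fin_num by exact: fin_num_measure.
move: muV; rewrite (chargeDI mu mV mF) (setIidr FV); move: muVF.
case: (mu F) => // r; case: (mu (V `\` F)) => // s.
rewrite !abse_EFin !lte_fin lee_fin => se rse _ _.
rewrite -[r](addKr s) addrC; apply: le_trans (ler_normB _ _) _.
by apply: lerD; exact: ltW.
Qed.

(** Inner regularity leaves a closed subset, which is nowhere dense and thus null, and a remainder
    of small total variation. *)
Lemma normal_measure_nowhere_dense (A : set (borel x0)) :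
  measurable A -> nowhere_dense (A : set K) -> mu A = 0.
Proof.
move=> mA ndA; have [reg _] := mu_normal; have [cptK hausK _] := hK.
apply/eqP; rewrite -abse_eq0 eq_le abse_ge0 andbT.
apply/lee_addgt0Pr => e e0; rewrite add0e.
have [F [ O [cptF oO FA AO tvO]]] := reg A e mA e0.
have cF : closed F by exact: compact_closed.
have mF : measurable (F : set (borel x0)) by exact: closed_borel.
have mAF : measurable (A `\` F) by exact: measurableD.
rewrite (chargeDI mu mA mF) (setIidr FA).
rewrite (normal_measure_closed_nowhere_dense cF (nowhere_denseS FA ndA)) adde0.
apply: le_trans (abse_le_total_variation mAF) (le_trans _ (ltW tvO)).
apply: le_measure; rewrite ?in_setE//; last exact: setSD.
by apply: measurableD => //; exact: open_borel.
Qed.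

Lemma total_variation_nowhere_dense (A : set (borel x0)) :
  measurable A -> nowhere_dense (A : set K) -> tv A = 0.
Proof.
move=> mA ndA; rewrite /tv charge_total_variationE.
have [P [N [mP mN -> // -> //]]] := charge_parts_hahn mu.
rewrite !normal_measure_nowhere_dense ?oppe0 ?adde0//; try exact: measurableI;
  by apply: nowhere_denseS ndA; exact: subIsetl.
Qed.

(** The pieces of a meagre set need not be Borel; their closures are, and remain nowhere dense. *)
Lemma total_variation_meagre (A : set (borel x0)) :
  measurable A -> meagre (A : set K) -> tv A = 0.
Proof.
move=> mA [F ndF AF]; apply/eqP; rewrite eq_le measure_ge0 andbT.
have mcF n : measurable (closure (F n) : set (borel x0)).
  by apply: closed_borel; exact: closed_closure.
apply: (@le_trans _ _ (\sum_(n <oo) tv (closure (F n)))).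
  apply: measure_sigma_subadditive => //.
  by rewrite AF; apply: subset_bigcup => n _; exact: subset_closure.
rewrite eseries0// => n _ _; apply: total_variation_nowhere_dense => //.
rewrite /nowhere_dense -((closure_id _).1 (@closed_closure _ (F n))).
exact: ndF.
Qed.

Lemma open_setC_support : open (~` charge_support mu).
Proof.
rewrite openE => x /existsNP[V /not_implyP[[oV Vx] tvV]].
rewrite /interior /= nbhsE; exists V => // y Vy Sy; apply: tvV; exact: Sy.
Qed.

(** The null open sets may form an uncountable cover of [W]; on a compact subset finitely many
    suffice, and inner regularity bounds the rest. *)
Lemma total_variation_null_sets (W : set K) : open W ->
  (forall x, W x -> exists V : set K, [/\ open V, V x & tv V = 0]) -> tv W = 0.
Proof.
move=> oW Wnull; have [reg _] := mu_normal; have [cptK hausK _] := hK.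
have mW : measurable (W : set (borel x0)) by exact: open_borel.
apply/eqP; rewrite eq_le measure_ge0 andbT.
apply/lee_addgt0Pr => e e0; rewrite add0e.
have [F [ O [cptF oO FW WO tvO]]] := reg W e mW e0.
have mF : measurable (F : set (borel x0)).
  by apply: closed_borel; exact: compact_closed.
have /choice[V VP] (x : K) : exists V : set K,
    W x -> [/\ open V, V x & tv V = 0].
  by have [/Wnull[V]|nWx] := pselect (W x); [exists V|exists set0].
have tvF : tv F = 0.
  have : cover_compact (F : set (pointed_at x0)) by rewrite -compact_cover.
  move=> /(_ K W V)[x Wx|x Fx|D' D'W FD'].
  - by have [] := VP x Wx.
  - by exists x; [exact: FW|have [] := VP x (FW _ Fx)].
  apply/eqP; rewrite eq_le measure_ge0 andbT.
  have VD' i : i \in D' -> measurable (V i : set (borel x0)) /\ tv (V i) = 0.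
    move=> /D'W/set_mem/VP[oV _ tvV]; split => //; exact: open_borel.
  have [mB tvB] : measurable (\bigcup_(i in [set` D']) V i : set (borel x0)) /\
      tv (\bigcup_(i in [set` D']) V i) = 0.
    rewrite bigcup_fset big_seq.
    elim/big_ind : _ => [|A B [mA tvA] [mB tvB]|i]; last exact: VD'.
      by split; [exact: measurable0|exact: measure0].
    split; first exact: measurableU.
    apply/eqP; rewrite eq_le measure_ge0 andbT.
    apply: le_trans (measureU2 _ mA mB) _.
    by rewrite [X in X + _]tvA [X in _ + X]tvB adde0.
  by rewrite -tvB; apply: le_measure; rewrite ?in_setE.
rewrite (measureDI _ mW mF) (setIidr FW) [X in _ + X]tvF adde0.
apply: le_trans (ltW tvO); apply: le_measure; rewrite ?in_setE//.
- exact: measurableD.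
- by apply: measurableD => //; exact: open_borel.
- exact: setSD.
Qed.

Lemma total_variation_setC_support : tv (~` charge_support mu) = 0.
Proof.
apply: total_variation_null_sets; first exact: open_setC_support.
move=> x /existsNP[V /not_implyP[[oV Vx] tvV]]; exists V; split => //.
by apply/eqP; rewrite eq_le measure_ge0 andbT leNgt; apply/negP.
Qed.

(** The interior of the closed set [S] is clopen, and [S] exceeds it by a nowhere dense, hence null,
    set. So the complement of the interior is an open null set and contains no point of [S]. *)
Lemma clopen_support : clopen (charge_support mu).
Proof.
set S := charge_support mu.
have cS : closed S.
  by rewrite -(setCK S); apply: open_closedC; exact: open_setC_support.
have mS : measurable (S : set (borel x0)) by exact: closed_borel.
have oI : open S° by exact: open_interior.
have cI : closed S°.
  have [ocI ccI] := clopen_closure hK oI.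
  suff -> : S° = closure S° by [].
  apply/seteqP; split; first exact: subset_closure.
  rewrite -{1}[closure S°](interior_id _).1//; apply: interiorS.
  rewrite [S in _ `<=` S](closure_id _).1//; apply: closureS.
  exact: interior_subset.
suff SI : S `<=` S°.
  split => //; rewrite (_ : S = S°)//; apply/seteqP; split => //.
  exact: interior_subset.
have mI : measurable (S° : set (borel x0)) by exact: open_borel.
have ndB : nowhere_dense (S `\` S°).
  apply/nowhere_denseP => W oW W0.
  have [WI|/set0P WI] := eqVneq (W `&` S°) set0; last first.
    exists (W `&` S°); split => //; first exact: openI.
    by rewrite -subset0 => x [[_ ?] []].
  exists (W `&` ~` S); split => //.
  - by apply: openI => //; exact: closed_openC.
  - apply: contrapT => WS; case: W0 => x Wx.
    suff : (W `&` S°) x by rewrite WI.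
    split => //; suff WS' : W `<=` S by rewrite /interior nbhsE; exists W.
    by move=> y Wy; apply: contrapT => nSy; apply: WS; exists y.
  - by rewrite -subset0 => x [[_ nSx] []].
have tvI : tv (~` S°) = 0.
  apply/eqP; rewrite eq_le measure_ge0 andbT.
  apply: (@le_trans _ _ (tv (~` S `|` (S `\` S°)))).
    apply: le_measure; rewrite ?in_setE.
    - exact: measurableC.
    - by apply: measurableU; [exact: measurableC|exact: measurableD].
    - by move=> x nIx; have [Sx|nSx] := pselect (S x); [right|left].
  apply: le_trans (measureU2 _ _ _) _.
  - exact: measurableC.
  - exact: measurableD.
  by rewrite [X in X + _]total_variation_setC_support add0e
     [X in X <= _]total_variation_nowhere_dense//; exact: measurableD.
move=> x Sx; apply: contrapT => nIx.
have := Sx (~` S°); rewrite [X in _ < X]tvI ltxx => /(_ _).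
by move=> h; suff : false by []; apply: h; split => //; exact: closed_openC.
Qed.

Lemma normal_measure_star3 : property_star3 R (set_type (charge_support mu)).
Proof.
set S := charge_support mu; have [oS cS] : clopen S := clopen_support.
pose im (V : set (set_type S)) : set K := set_val @` V.
have oim V : open V -> open (im V).
  move=> [M oM <-]; rewrite (_ : im _ = M `&` S); first exact: openI.
  apply/seteqP; split=> [_ [y My <-]|x [Mx Sx]].
    by split => //; exact: set_valP.
  by exists (exist _ x (mem_set Sx)).
have mim V : open V -> measurable (im V : set (borel x0)).
  by move=> oV; apply: open_borel; exact: oim.
pose w V := fine (tv (im V)).
have wE V : open V -> tv (im V) = (w V)%:E.
  by move=> oV; rewrite fineK// charge_total_variation_fin//; exact: mim.
have w_le V W : open V -> open W -> V `<=` W -> (w V <= w W)%R.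
  move=> oV oW VW; rewrite -lee_fin -!wE//; apply: le_measure.
  - by rewrite in_setE; exact: mim.
  - by rewrite in_setE; exact: mim.
  - exact: image_subset.
have w_gt0 V : open V -> V !=set0 -> (0 < w V)%R.
  move=> oV [y Vy]; rewrite -lte_fin -wE//.
  have := set_valP y; apply; split; first exact: oim.
  by exists y.
have w_meagre V W : open V -> open W -> meagre (V `+` W) -> w V = w W.
  move=> oV oW mVW; apply: EFin_inj; rewrite -!wE//.
  (* A set meagre in the subspace has meagre image in [K], where the total variation vanishes on
     measurable meagre sets. *)
  have null A B : open A -> open B -> meagre (A `\` B) ->
      tv (im A `\` im B) = 0.
    move=> oA oB mAB; apply: total_variation_meagre.
      by apply: measurableD; exact: mim.
    apply: meagreS (meagre_image_val oS mAB) => _ [[y Ay <-] nB].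
    by exists y => //; split => // By; apply: nB; exists y.
  have nVW : tv (im V `\` im W) = 0.
    by apply: null => //; apply: meagreS mVW => x; left.
  have nWV : tv (im W `\` im V) = 0.
    by apply: null => //; apply: meagreS mVW => x; right.
  rewrite [LHS](measureDI _ (mim _ oV) (mim _ oW)).
  rewrite [RHS](measureDI _ (mim _ oW) (mim _ oV)).
  by rewrite [X in X + _ = _]nVW [X in _ = X + _]nWV !add0e setIC.
pose eps n : R := (n.+1%:R^-1)%R.
have eps_gt0 n : (0 < eps n)%R by rewrite invr_gt0.
(* Class 0 collects the sets of measure above 1. In general [n] is the least index with
   [eps n < w V], so the classes are disjoint and exhaust the nonempty open sets. *)
pose TT n := [set V : set (set_type S) |
  [/\ open V, (eps n < w V)%R & forall k, (k < n)%N -> (w V <= eps k)%R]].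
exists TT; split.
- move=> n k _ _ [V [[oV nV Vn] [_ kV Vk]]].
  case: (ltngtP n k) => // lt_nk.
    by have := Vk _ lt_nk; rewrite leNgt nV.
  by have := Vn _ lt_nk; rewrite leNgt kV.
- apply/seteqP; split=> [V [n _ [oV nV _]]|V [oV V0]].
    split => //; apply: contrapT => nV0.
    have V0 : V = set0 by apply/seteqP; split => // x Vx; apply: nV0; exists x.
    move: nV; rewrite /w V0 /im image_set0 [X in fine X]measure0 /=.
    by rewrite ltNge ltW.
  have exn : exists n, (eps n < w V)%R.
    have [N _ hN] := near_infty_natSinv_lt (PosNum (w_gt0 _ oV V0)).
    by exists N; exact: (hN N (leqnn N)).
  have [n nV nmin] := find_ex_minn exn; exists n => //; split => // k kn.
  by rewrite leNgt; apply/negP => /nmin; rewrite leqNgt kn.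
- move=> n; split.
  (* The intersection number is at least [eps n / M]; the added 1 keeps [M] positive. *)
  + pose M := (1 + fine (tv setT))%R.
    have M0 : (0 < M)%R by rewrite ltr_pwDl// fine_ge0.
    apply: (@lt_le_trans _ _ (eps n / M)%:E).
      by rewrite lte_fin divr_gt0.
    apply: le_ereal_inf_tmp => _ [k [F [k0 TF ->]]].
    rewrite lee_fin ler_pdivrMr// mulrAC ler_pdivlMr ?ltr0n//.
    have mF j : measurable (im (F j) : set (borel x0)).
      by apply: mim; have [] := TF j.
    have iF : (kelley_i (fun j => im (F j)) <= kelley_i F)%N.
      apply/bigmax_leqP => J /asboolP[x Jx].
      (* A common point of the images is known to come from the subspace only when [J] is
         nonempty. *)
      have [->|[j0 j0J]] := finset.set_0Vmem J; first by rewrite cards0.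
      have [y _ yx] := Jx j0 j0J.
      apply: (@leq_bigmax_cond _ (fun J : {set 'I_k} =>
        `[< \bigcap_(j in [set` J]) F j !=set0 >])
        (fun J : {set 'I_k} => #|J|)).
      apply/asboolP; exists y => j jJ; have [z Fz zx] := Jx j jJ.
      by rewrite (_ : y = z)//; apply: val_inj; move: yx; rewrite -zx.
    have := sum_measure_le_kelley_i tv mF.
    have -> : tv setT = (fine (tv setT))%:E.
      by rewrite fineK// charge_total_variation_fin.
    rewrite (eq_bigr (fun j => (w (F j))%:E)); last first.
      by move=> j _; apply: wE; have [] := TF j.
    rewrite sumEFin -EFinM lee_fin => sumw.
    apply: (@le_trans _ _ (\sum_(j < k) w (F j))%R).
      rewrite mulr_natr -[k in leLHS]card_ord -sumr_const.
      by apply: ler_sum => j _; apply: ltW; have [] := TF j.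
    apply: (le_trans sumw); apply: ler_pM.
    - exact: ler0n.
    - exact: fine_ge0.
    - by rewrite ler_nat.
    - by rewrite /M lerDr.
  + move=> U oU ndU [oUU nU Uk].
    have oUm m : open (U m) by exact: oU.
    have Umle m : (w (U m) <= w (\bigcup_m U m))%R.
      by apply: w_le => //; exact: bigcup_sup.
    suff [m nm] : exists m, (eps n < w (U m))%R.
      exists m; split => // k kn; exact: le_trans (Umle m) (Uk _ kn).
    (* By continuity from below, the bounds [w (U m) <= eps n] for all [m] would pass to the
       union. *)
    apply: contrapT => noM; move: nU; apply/negP; rewrite -leNgt.
    rewrite -lee_fin -wE//.
    have -> : im (\bigcup_m U m) = \bigcup_m im (U m) by exact: image_bigcup.
    have mUm m : measurable (im (U m) : set (borel x0)) by exact: mim.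
    have cv : tv \o (fun m => im (U m)) @ \oo --> tv (\bigcup_m im (U m)).
      apply: (@nondecreasing_cvg_mu _ (borel x0) R tv) => //.
        exact: bigcupT_measurable.
      move=> i j ij; apply/subsetPset; apply: image_subset.
      by apply/subsetPset; exact: ndU.
    rewrite -(cvg_lim _ cv)//; apply: lime_le.
      by apply/cvg_ex; exists (tv (\bigcup_m im (U m))).
    apply: nearW => m /=; rewrite wE// lee_fin leNgt; apply/negP => nm.
    by apply: noM; exists m.
  + move=> V W [oV nV Vk] oW mVW; have wVW := w_meagre _ _ oV oW mVW.
    by split => //; rewrite -wVW.
Qed.

End normal_measure_support.

(** * Hyper-Stonean spaces and the three-star property *)

Section star3_normal_measure.
Context (R : realType) (K : topologicalType).
Hypothesis hK : stonean K.
Local Open Scope ereal_scope.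

(** An empty class has intersection number [+oo], and then any positive constant serves. Constant
    and content form one pair so that a single choice selects both for all classes. *)
Lemma kelley_k_gt0_measure (L : topologicalType) (x : L) (FF : set (set L)) :
  0 < kelley_k R FF ->
  exists p : R * (set L -> R), [/\ (0 < p.1)%R, forall A, (0 <= p.2 A)%R,
    forall A B, A `&` B = set0 -> p.2 (A `|` B) = (p.2 A + p.2 B)%R,
    (p.2 setT <= 1)%R & forall A, FF A -> (p.1 <= p.2 A)%R].
Proof.
move=> k0; have [c c0 ck] : exists2 c : R, (0 < c)%R & c%:E <= kelley_k R FF.
  move: k0; case: (kelley_k R FF) => [r| |]//; first by exists r.
  by exists 1%R; rewrite ?leey.
have [m [m0 mU m1 mc]] := @kelley R (pointed_at x) FF c ck.
by exists (c, m).
Qed.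

Lemma star3_normal_measure (U : set K) (x : K) :
  clopen U -> property_star3 R (set_type U) -> U x ->
  exists (x0 : K) (mu : {charge set (borel x0) -> \bar R}),
    normal_measure mu /\ charge_support mu x.
Proof.
move=> cU [TT [_ TTcov TTP]] Ux; have [oU _] := cU.
pose y0 : set_type U := exist _ x (mem_set Ux).
have k_gt0 n : 0 < kelley_k R (TT n) by have [] := TTP n.
have /choice[p pP] := fun n => kelley_k_gt0_measure y0 (k_gt0 n).
(* The weights sum to 1 and each content has mass at most 1, so [m] is finite. *)
pose a n : R := (1 / (2 ^ n.+1)%:R)%R.
have a_gt0 n : (0 < a n)%R by rewrite divr_gt0// ltr0n expn_gt0.
pose pre (A : set K) : set (set_type U) := set_val @^-1` A.
pose t (A : set K) n : \bar R := (a n * (p n).2 (pre A))%:E.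
have t_ge0 A n : 0 <= t A n.
  rewrite lee_fin mulr_ge0//; first exact: ltW.
  by have [_ p0 _ _ _] := pP n; exact: p0.
pose m (A : set K) : \bar R := \sum_(n <oo) t A n.
have m_ge0 A : 0 <= m A by apply: nneseries_ge0 => n _ _; exact: t_ge0.
have mU A B : A `&` B = set0 -> m (A `|` B) = m A + m B.
  move=> AB; rewrite /m -nneseriesD => [|n _ _|n _ _]; do ?exact: t_ge0.
  apply: eq_eseriesr => n _; have [_ _ pU _ _] := pP n.
  rewrite /t /pre preimage_setU pU -?EFinD ?mulrDr//.
  by rewrite -preimage_setI AB preimage_set0.
have m_fin : m setT < +oo.
  apply: (@le_lt_trans _ _ 1%:E); last exact: ltry.
  apply: le_trans (epsilon_trick0 xpredT ler01).
  apply: lee_nneseries => [n _ _|n _]; first exact: t_ge0.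
  rewrite lee_fin /pre preimage_setT; apply: ler_piMr; first exact: ltW.
  by have [_ _ _ p1 _] := pP n.
have [nu [nu_meagre nu_clopen nu_ge]] :=
  category_measure_exists x hK m_ge0 mU m_fin.
have nuU : nu (~` U) = 0.
  apply/eqP; rewrite eq_le measure_ge0 andbT.
  apply: le_trans (nu_clopen _ (@clopenC _ U U cU)) _.
  rewrite /m eseries0// => n _ _; rewrite /t.
  have -> : pre (~` U) = set0.
    by rewrite -subset0 => y /=; apply; exact: set_valP.
  have [_ _ pU _ _] := pP n; have := pU _ _ (set0I set0); rewrite setU0.
  by move=> p00; congr EFin; rewrite (_ : (p n).2 set0 = 0%R) ?mulr0//; lra.
have nu_pos (V : set K) : open V -> V `&` U !=set0 -> 0 < nu V.
  move=> oV [y [Vy Uy]].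
  (* The trace of [V] on [U] lies in some class [n], on which the term of index [n] alone bounds [m]
     below by [a n * (p n).1]. *)
  have [n _ TTV] : (\bigcup_n TT n) (pre V).
    rewrite TTcov; split; first by exists V.
    by exists (exist _ y (mem_set Uy)).
  have [_ TTup TTmeagre] := TTP n; have [c0 _ _ _ pc] := pP n.
  apply: (@lt_le_trans _ _ (a n * (p n).1)%:E).
    by rewrite lte_fin mulr_gt0.
  apply: (nu_ge [set F | TT n (pre F)]) => //.
  - move=> F TTF; apply: (@le_trans _ _ (t F n)).
      by rewrite lee_fin ler_pM2l//; exact: pc.
    apply: le_trans (nneseries_lim_ge n.+1 _); last first.
      by move=> k _ _; exact: t_ge0.
    rewrite big_mkord big_ord_recr/= leeDr//.
    by apply: sume_ge0 => k _; exact: t_ge0.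
  - move=> W oW ndW; rewrite /= /pre preimage_bigcup => TTW.
    apply: TTup TTW.
      by move=> k; exists (W k).
    move=> i j ij; apply/subsetPset; apply: preimage_subset.
    by apply/subsetPset; exact: ndW.
  - move=> F W /= TTF oW mFW; apply: TTmeagre TTF _ _; first by exists W.
    exact: (meagre_preimage_val oU mFW).
exists x, (charge_of_finite_measure nu); split.
  exact: (finite_measure_normal hK nu_meagre oU nuU nu_pos).
exact: (support_of_positive nu_pos Ux).
Qed.

End star3_normal_measure.

(* [set_type U] is U with the subspace topology. *)
Theorem theorem5p6 (R : realType) (K : topologicalType) (hK : stonean K) :
  hyper_stonean R K <->
  exists UU : set (set K),
    [/\ forall U, UU U -> clopen U,
        dense (\bigcup_(U in UU) U) &
        forall U, UU U -> property_star3 R (set_type U)].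
Proof.
split=> [[_ dK]|[UU [cUU dUU sUU]]].
  exists [set U | exists (x0 : K) (mu : {charge set (borel x0) -> \bar R}),
    normal_measure mu /\ U = charge_support mu]; split.
  - by move=> _ [x0 [mu [nmu ->]]]; exact: clopen_support.
  - move=> W W0 oW; have [x [Wx [x0 [mu [nmu mux]]]]] := dK W W0 oW.
    by exists x; split => //; exists (charge_support mu) => //; exists x0, mu.
  - by move=> _ [x0 [mu [nmu ->]]]; exact: normal_measure_star3.
split => // W W0 oW; have [x [Wx [U UUU Ux]]] := dUU W W0 oW.
exists x; split => //.
exact: (star3_normal_measure hK (cUU _ UUU) (sUU _ UUU) Ux).
Qed.
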